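(* Let $t\ge3$ and let $f:[N]\times[m]\to\{0,1\}$ be a data structure problem such that there is a $2^{-\Omega(t)}n^{-t}$-biased distribution over $\{0,1\}^m$ supported on the rows $\{f(i,\cdot):i\in[N]\}$, where $n=S$. Then any non-adaptive bit-probe data structure for $f$ with time $t$ requires space $$S\ge\tilde\Omega\bigl(m^{2/(t-1)}\bigr),$$ where $\tilde\Omega$ hides a $\mathrm{polylog}(m)$ factor and a constant depending on $t$.
   Context: A distribution $\mathcal D$ over $\{0,1\}^m$ is $\gamma$-biased if for every nonempty $I\subseteq[m]$, $\frac12(1-\gamma)\le\Pr_{\mathbf x\sim\mathcal D}[\bigoplus_{i\in I}\mathbf x_i=0]\le\frac12(1+\gamma)$. A non-adaptive bit-probe data structure for $f$ with space $S$ and time $t$ maps each $i\in[N]$ to a memory string $E\in\{0,1\}^S$, and for each query $j\in[m]$ reads a fixed set (depending only on $j$) of at most $t$ bits of $E$ and outputs $f(i,j)$ correctly as a function of those bits. *)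

(* Defs.v *)
From HB Require Import structures.
From mathcomp Require Import all_boot all_order all_algebra.
From mathcomp Require Import reals exp.

Set Implicit Arguments.
Unset Strict Implicit.
Unset Printing Implicit Defensive.

Import Order.TTheory GRing.Theory Num.Theory.
Local Open Scope ring_scope.

Definition bits (n : nat) : finType := {ffun 'I_n -> bool}.

Record distr (R : realType) (m : nat) := Distr {
  pmf :> bits m -> R;
  pmf_ge0 : forall x, 0 <= pmf x;
  pmf_sum1 : \sum_x pmf x = 1
}.

Definition Pr (R : realType) (m : nat) (D : distr R m) (A : pred (bits m)) : R :=
  \sum_(x | A x) D x.

Definition parity (m : nat) (I : {set 'I_m}) (x : bits m) : bool :=
  \big[addb/false]_(i in I) x i.

Definition biased (R : realType) (m : nat) (gamma : R) (D : distr R m) : Prop :=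
  forall I : {set 'I_m}, I != set0 ->
    2^-1 * (1 - gamma) <= Pr D (fun x => parity I x == false)
      <= 2^-1 * (1 + gamma).

Definition problem (N m : nat) := 'I_N -> 'I_m -> bool.

Definition row (N m : nat) (f : problem N m) (i : 'I_N) : bits m :=
  [ffun j => f i j].

Definition supported_on_rows (R : realType) (N m : nat)
    (D : distr R m) (f : problem N m) : Prop :=
  forall x, D x != 0 -> exists i : 'I_N, x = row f i.

Definition read (S : nat) (Q : {set 'I_S}) (E : bits S) :
    {ffun {k : 'I_S | k \in Q} -> bool} :=
  [ffun k => E (val k)].

(* Non-adaptivity: the probed set depends on the query only, and the answer  *)
(* is computed from the contents of the probed cells alone.                  *)
Record nonadaptive_ds (N m : nat) (f : problem N m) (S t : nat) := NonadaptiveDS {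
  encode : 'I_N -> bits S;
  probes : 'I_m -> {set 'I_S};
  decode : forall j : 'I_m, {ffun {k : 'I_S | k \in probes j} -> bool} -> bool;
  probes_le : forall j, (#|probes j| <= t)%N;
  decodeP : forall i j, decode (read (probes j) (encode i)) = f i j
}.

(* Main.v *)
(* Write n = S, d = t - 1, and view answers as signs y_j = g_j(E), g_j a        *)
(* function of t cells. More than n of the g_j being the parity of all their   *)
(* t cells up to sign would force a parity of answers to be constant, so       *)
(* assume that most are not. For these the part r_j of g_j of Fourier degree   *)
(* < t satisfies g_j r_j >= 2^(1-t) pointwise. Hence some Fourier type of      *)
(* degree d has a sum over j of w_j y_j chi_(T_j)(E) of order m on a constant  *)
(* fraction of the answer strings.                                             *)
(* Write chi_(T_j) = alpha(a_j) beta(A_j) beta'(B_j), where a_j is one cell    *)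
(* and A_j, B_j split the other d - 1 evenly. Cauchy-Schwarz over the value of *)
(* a_j leaves a quadratic form with entries y_j y_j', a_j = a_j', from         *)
(* (A_j, B_j') to (A_j', B_j): a symmetric matrix on n^(d-1) vertices. After   *)
(* degree normalisation a high moment of it is a sum over walks: those whose   *)
(* labels do not cancel contribute at most the bias, and those whose labels    *)
(* cancel are rare as soon as m >= n^(d/2) polylog(n). The normalisation keeps *)
(* the total weight of the walks bounded, so that a bias n^-t suffices even    *)
(* for walks of length log n.                                                  *)

Require Import Defs.
From HB Require Import structures.
From mathcomp Require Import all_boot all_order all_algebra.
From mathcomp Require Import reals exp.
From mathcomp Require Import ring lra zify.

Set Implicit Arguments.
Unset Strict Implicit.
Unset Printing Implicit Defensive.

Import Order.TTheory GRing.Theory Num.Theory.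
Local Open Scope ring_scope.

(** * Characters of the cube and small bias *)

Definition symdiff (T : finType) (X Y : {set T}) : {set T} :=
  [set j | (j \in X) (+) (j \in Y)].

Lemma symdiffK (T : finType) (Y : {set T}) :
  involutive (fun X : {set T} => symdiff X Y).
Proof. by move=> X; apply/setP => j; rewrite !inE addbK. Qed.

Lemma symdiff_eq0 (T : finType) (X Y : {set T}) :
  (symdiff X Y == set0) = (X == Y).
Proof.
apply/eqP/eqP => [XY0|->]; apply/setP => j; last by rewrite !inE addbb.
by move/setP/(_ j): XY0; rewrite !inE; do 2![case: (_ \in _)].
Qed.

Lemma card_symdiff_ge (T : finType) (X Y : {set T}) :
  (#|X| <= #|symdiff X Y| + #|Y|)%N.
Proof.
apply: leq_trans (leq_card_setU _ _); apply/subset_leq_card/subsetP => j.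
by rewrite !inE => ->; case: (_ \in _).
Qed.

Lemma card_symdiff_disjoint (T : finType) (X Y : {set T}) :
  [disjoint X & Y] -> #|symdiff X Y| = (#|X| + #|Y|)%N.
Proof.
move=> dXY; rewrite -cardsUI disjoint_setI0 // cards0 addn0.
apply: eq_card => j; rewrite !inE.
by have := disjointFr dXY (x := j); case: (j \in X) => // ->.
Qed.

Section Characters.
Variables (R : realType) (m : nat).

Definition chi (X : {set 'I_m}) (y : bits m) : R :=
  \prod_(j in X) (-1) ^+ y j.

Lemma chi0 y : chi set0 y = 1.
Proof. by rewrite /chi big_set0. Qed.

Lemma chiM X Y y : chi X y * chi Y y = chi (symdiff X Y) y.
Proof.
rewrite /chi [Z in Z * _]big_mkcond [Z in _ * Z]big_mkcond [RHS]big_mkcond -big_split; apply: eq_bigr => j _ /=.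
by rewrite inE; do 2![case: (_ \in _)]; case: (y j); rewrite /= ?mulr1 ?mul1r ?mulrNN ?mulr1.
Qed.

Lemma chi_sqr X y : chi X y * chi X y = 1.
Proof.
rewrite chiM; suff /eqP-> : symdiff X X == set0 by rewrite chi0.
by rewrite symdiff_eq0.
Qed.

Lemma chi_parity X y : chi X y = (-1) ^+ parity X y.
Proof.
rewrite /chi /parity; elim/big_rec2: _ => // j b r _ ->.
by rewrite signr_addb.
Qed.

Lemma normr_chi X y : `|chi X y| = 1.
Proof. by rewrite chi_parity normrX normrN1 expr1n. Qed.

Definition Ex (D : distr R m) (f : bits m -> R) : R := \sum_y D y * f y.

Lemma ler_Ex (D : distr R m) f g :
  (forall y, D y != 0 -> f y <= g y) -> Ex D f <= Ex D g.
Proof.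
move=> fg; apply: ler_sum => y _.
have [->|Dy] := eqVneq (D y) 0; first by rewrite !mul0r.
by rewrite ler_wpM2l ?pmf_ge0 ?fg.
Qed.

Lemma ExZ (D : distr R m) a f : Ex D (fun y => a * f y) = a * Ex D f.
Proof. by rewrite /Ex mulr_sumr; apply: eq_bigr => y _; rewrite mulrCA. Qed.

Lemma Ex_cst (D : distr R m) a : Ex D (fun=> a) = a.
Proof. by rewrite /Ex -mulr_suml pmf_sum1 mul1r. Qed.

Lemma Ex_sum (D : distr R m) (K : finType) (P : pred K) (f : K -> bits m -> R) :
  Ex D (fun y => \sum_(i | P i) f i y) = \sum_(i | P i) Ex D (f i).
Proof.
by rewrite /Ex exchange_big; apply: eq_bigr => y _; rewrite mulr_sumr.
Qed.

Lemma biased_Ex_chi (D : distr R m) gamma X :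
  biased gamma D -> X != set0 -> `|Ex D (chi X)| <= gamma.
Proof.
move=> bD X0; have := bD X X0; set q := Pr _ _.
suff -> : Ex D (chi X) = 2 * q - 1 by rewrite ler_norml; lra.
have -> : 2 * q - 1 = 2 * q - \sum_y D y by rewrite pmf_sum1.
rewrite /q /Pr big_mkcond mulr_sumr -sumrB.
apply: eq_bigr => y _; rewrite chi_parity; case: (parity X y) => /=.
  by rewrite mulr0 sub0r mulrN1.
by ring.
Qed.

End Characters.

(** Weighted Cauchy-Schwarz from Lagrange's identity: twice the difference of the two sides is a
    weighted sum of squares of 2 by 2 minors. *)
Lemma sum_mulr_sqr_le (R : realType) (V : finType) (rho f g : V -> R) :
  (forall v, 0 <= rho v) ->
  (\sum_v rho v * f v * g v) ^+ 2
    <= (\sum_v rho v * f v ^+ 2) * (\sum_v rho v * g v ^+ 2).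
Proof.
move=> rho0.
have : 0 <= \sum_v \sum_w rho v * rho w * (f v * g w - f w * g v) ^+ 2.
  by apply: sumr_ge0 => v _; apply: sumr_ge0 => w _; rewrite mulr_ge0 ?sqr_ge0 // mulr_ge0.
suff -> : \sum_v \sum_w rho v * rho w * (f v * g w - f w * g v) ^+ 2 =
  2 * ((\sum_v rho v * f v ^+ 2) * (\sum_v rho v * g v ^+ 2)
       - (\sum_v rho v * f v * g v) ^+ 2).
  by rewrite pmulr_rge0 // subr_ge0.
set F := fun v => rho v * f v ^+ 2; set G := fun v => rho v * g v ^+ 2.
set H := fun v => rho v * f v * g v.
transitivity (\sum_v \sum_w (F v * G w + F w * G v - 2 * (H v * H w))).
  by apply: eq_bigr => v _; apply: eq_bigr => w _; rewrite /F /G /H; ring.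
transitivity (\sum_v (F v * (\sum_w G w) + (\sum_w F w) * G v
   - 2 * (H v * \sum_w H w))).
  by apply: eq_bigr => v _; rewrite !big_split /= sumrN -!mulr_sumr mulr_suml.
rewrite !big_split /= sumrN -mulr_suml -mulr_sumr -mulr_sumr -mulr_suml.
by ring.
Qed.

(** * Moments of a random quadratic form *)

Section Walks.
Variables (R : realType) (m : nat) (V Ed : finType) (src dst : Ed -> V).
Variable lam : Ed -> {set 'I_m}.

(* [walk_coef p k v v' X] is the total [p]-weight of the [k]-step walks from *)
(* [v] to [v'] whose labels add up to [X] modulo 2.                          *)
Fixpoint walk_coef (p : Ed -> R) k v v' X : R :=
  if k is k'.+1 then
    \sum_(e | src e == v) p e * walk_coef p k' (dst e) v' (symdiff X (lam e))
  else ((v == v') && (X == set0))%:R.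

Definition signed_step (p : Ed -> R) (y : bits m) (f : V -> R) (v : V) : R :=
  \sum_(e | src e == v) p e * chi R (lam e) y * f (dst e).

Definition walk_poly p k v v' (y : bits m) : R :=
  \sum_X walk_coef p k v v' X * chi R X y.

(** Prepending an edge multiplies by the character of its label, which shifts the index [X]. Powers
    of the step operator thus become polynomials in the signs, whose coefficients do not depend on
    [y]. *)
Lemma iter_signed_step p y k u v :
  iter k (signed_step p y) u v = \sum_v' walk_poly p k v v' y * u v'.
Proof.
elim: k v => [|k IHk] v /=.
  rewrite (bigD1 v) //= big1 => [|v' v'v]; last first.
    rewrite /walk_poly big1 ?mul0r // => X _ /=.
    by rewrite eq_sym (negbTE v'v) mul0r.
  rewrite /walk_poly (bigD1 set0) //= !eqxx chi0 big1 => [|X /negbTE X0].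
    by rewrite !addr0 !mul1r.
  by rewrite X0 andbF mul0r.
transitivity (\sum_(e | src e == v) \sum_v'
    p e * chi R (lam e) y * walk_poly p k (dst e) v' y * u v').
  by apply: eq_bigr => e _; rewrite IHk mulr_sumr; apply: eq_bigr => v' _; rewrite mulrA.
rewrite exchange_big; apply: eq_bigr => v' _ /=.
rewrite -mulr_suml; congr (_ * _); rewrite /walk_poly /=.
under [RHS]eq_bigr do rewrite mulr_suml.
rewrite exchange_big; apply: eq_bigr => e _ /=.
rewrite (reindex_inj (inv_inj (symdiffK (lam e)))) mulr_sumr /=.
apply: eq_bigr => X _; rewrite -chiM; set w := walk_coef _ _ _ _ _.
transitivity (p e * w * chi R X y * (chi R (lam e) y * chi R (lam e) y)).
  by ring.
by rewrite chi_sqr mulr1.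
Qed.

Variables (p : Ed -> R).
Let P e := `|p e|.

Lemma walk_coef_ge0 k v v' X : 0 <= walk_coef P k v v' X.
Proof.
elim: k v X => [|k IHk] v X /=; first by rewrite ler0n.
by apply: sumr_ge0 => e _; rewrite mulr_ge0 ?normr_ge0.
Qed.

Lemma ler_norm_walk_coef k v v' X : `|walk_coef p k v v' X| <= walk_coef P k v v' X.
Proof.
elim: k v X => [|k IHk] v X /=; first by rewrite normr_nat.
apply: (le_trans (ler_norm_sum _ _ _)); apply: ler_sum => e _.
by rewrite normrM ler_wpM2l.
Qed.

Definition walk_mass k v X : R := \sum_v' walk_coef P k v v' X.

Lemma walk_massS k v X :
  walk_mass k.+1 v X =
  \sum_(e | src e == v) P e * walk_mass k (dst e) (symdiff X (lam e)).
Proof.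
by rewrite /walk_mass /= exchange_big; apply: eq_bigr => e _; rewrite mulr_sumr.
Qed.

Lemma walk_mass0 v X : walk_mass 0 v X = (X == set0)%:R.
Proof.
rewrite /walk_mass (bigD1 v) //= eqxx big1 ?addr0 // => v' /negbTE.
by rewrite eq_sym => ->.
Qed.

Hypothesis p1 : forall v, \sum_(e | src e == v) P e <= 1.

Lemma sum_walk_mass_le1 k v : \sum_X walk_mass k v X <= 1.
Proof.
elim: k v => [|k IHk] v.
  rewrite (bigD1 set0) //= walk_mass0 eqxx big1 ?addr0 // => X /negbTE X0.
  by rewrite walk_mass0 X0.
under eq_bigr do rewrite walk_massS.
rewrite exchange_big; apply: le_trans (p1 v); apply: ler_sum => e _.
rewrite -mulr_sumr ler_piMr ?normr_ge0 //.
have := IHk (dst e).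
by rewrite (reindex_inj (inv_inj (symdiffK (lam e)))).
Qed.

Hypothesis lam2 : forall e, (#|lam e| <= 2)%N.

(** A step alters at most two labels, so [k] steps cannot cancel more than [2 * k] of them. This is
    why [contract] is asked for small sets only. *)
Lemma walk_mass_eq0 k v (X : {set 'I_m}) : (2 * k < #|X|)%N -> walk_mass k v X = 0.
Proof.
elim: k v X => [|k IHk] v X hX.
  by rewrite walk_mass0; move: hX; rewrite muln0 card_gt0 => /negbTE->.
rewrite walk_massS big1 // => e _; rewrite IHk ?mulr0 //.
rewrite -(ltn_add2r 2); apply: leq_trans (leq_ltn_trans _ hX) _; first by rewrite mulnS addnC.
by apply: leq_trans (card_symdiff_ge _ (lam e)) _; rewrite leq_add2l.
Qed.

Variables (K : nat) (c theta : R).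
Hypotheses (c0 : 0 < c) (c1 : c <= 1) (theta0 : 0 <= theta).
Hypothesis contract : forall v (X : {set 'I_m}), (#|X| <= 2 * K)%N ->
  \sum_(e | src e == v) P e * c ^+ #|symdiff X (lam e)| <= theta * c ^+ #|X|.

(** [c ^+ #|X|] is a potential for the set of labels still to be cancelled: while that set is small,
    [contract] multiplies the average potential by at most [theta] per step, and a set that is too
    large carries no mass. *)
Lemma walk_mass_le k v (X : {set 'I_m}) :
  (k <= K)%N -> walk_mass k v X <= theta ^+ k * c ^+ #|X|.
Proof.
elim: k v X => [|k IHk] v X kK.
  rewrite walk_mass0 mul1r; case: eqP => [->|_]; first by rewrite cards0.
  by rewrite exprn_ge0 // ltW.
have [hX|hX] := leqP #|X| (2 * K); last first.
  rewrite walk_mass_eq0; first by rewrite mulr_ge0 ?exprn_ge0 // ltW.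
  by apply: leq_ltn_trans hX; rewrite leq_mul2l.
rewrite walk_massS exprS -mulrA mulrCA.
apply: le_trans (_ : theta ^+ k * (\sum_(e | src e == v) P e * c ^+ #|symdiff X (lam e)|) <= _).
  rewrite mulr_sumr; apply: ler_sum => e _; rewrite mulrCA.
  by rewrite ler_wpM2l ?normr_ge0 // IHk // ltnW.
by rewrite ler_wpM2l ?exprn_ge0 ?contract.
Qed.

(** Expand the square in characters. The diagonal terms are at most the largest mass times the total
    mass, hence [theta ^+ K]. Every other term has a character of expectation at most [gamma], and
    since the step is sub-stochastic the coefficients add up to at most 1 whatever the length, so
    [gamma] is not multiplied by a number of walks. *)
Lemma Ex_walk_poly_sqr (D : distr R m) gamma v :
  0 <= gamma -> biased gamma D ->
  Ex D (fun y => \sum_v' walk_poly p K v v' y ^+ 2) <= theta ^+ K + gamma.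
Proof.
move=> g0 bD; rewrite Ex_sum.
have sqE v' : Ex D (fun y => walk_poly p K v v' y ^+ 2) =
    \sum_X \sum_Y walk_coef p K v v' X * walk_coef p K v v' Y
      * Ex D (chi R (symdiff X Y)).
  under eq_bigr do under eq_bigr do rewrite -ExZ.
  under eq_bigr do rewrite -Ex_sum.
  rewrite -Ex_sum /Ex; apply: eq_bigr => y _; congr (_ * _).
  rewrite expr2 /walk_poly mulr_suml; apply: eq_bigr => X _.
  by rewrite mulr_sumr; apply: eq_bigr => Y _; rewrite -chiM; ring.
have sq_le v' : Ex D (fun y => walk_poly p K v v' y ^+ 2) <=
    \sum_X walk_coef P K v v' X ^+ 2 + gamma * (\sum_X walk_coef P K v v' X) ^+ 2.
  rewrite sqE expr2 mulr_suml mulr_sumr -big_split /=; apply: ler_sum => X _.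
  rewrite (bigD1 X) //=; apply: lerD.
    have /eqP-> : symdiff X X == set0 by rewrite symdiff_eq0.
    rewrite (_ : Ex _ _ = 1); last first.
      by rewrite -[RHS](Ex_cst D) /Ex; apply: eq_bigr => y _; rewrite chi0.
    by rewrite mulr1 -expr2 -[leLHS]ger0_norm ?sqr_ge0 // normrX lerXn2r ?nnegrE ?normr_ge0 ?walk_coef_ge0 ?ler_norm_walk_coef.
  apply: le_trans (_ : \sum_(Y | Y != X) gamma * (walk_coef P K v v' X * walk_coef P K v v' Y) <= _).
    apply: ler_sum => Y YX; apply: le_trans (ler_norm _) _; rewrite !normrM mulrC.
    apply: ler_pM; rewrite ?normr_ge0 ?mulr_ge0 ?normr_ge0 //.
      by apply: biased_Ex_chi; rewrite // symdiff_eq0 eq_sym.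
    by apply: ler_pM; rewrite ?normr_ge0 ?ler_norm_walk_coef.
  rewrite !mulr_sumr [leRHS](bigD1 X) //= lerDr.
  by rewrite !mulr_ge0 ?walk_coef_ge0.
apply: le_trans (ler_sum _ (fun v' _ => sq_le v')) _.
rewrite big_split /=; apply: lerD; last first.
  rewrite -mulr_sumr ler_piMr //.
  have := sum_walk_mass_le1 K v; rewrite /walk_mass exchange_big /= => le1.
  have S0 v' : 0 <= \sum_X walk_coef P K v v' X by apply: sumr_ge0 => X _; apply: walk_coef_ge0.
  apply: le_trans (le1); apply: ler_sum => v' _; rewrite expr2 ler_piMr //.
  by apply: le_trans le1; rewrite (bigD1 v') //= lerDl sumr_ge0.
rewrite exchange_big /=.
apply: le_trans (_ : \sum_X theta ^+ K * walk_mass K v X <= _); last first.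
  by rewrite -mulr_sumr ler_piMr ?exprn_ge0 ?sum_walk_mass_le1.
apply: ler_sum => X _; rewrite /walk_mass mulr_sumr; apply: ler_sum => v' _.
rewrite expr2 ler_wpM2r ?walk_coef_ge0 //.
apply: le_trans (_ : walk_mass K v X <= _).
  by rewrite /walk_mass (bigD1 v') //= lerDl sumr_ge0 // => w _; apply: walk_coef_ge0.
apply: le_trans (walk_mass_le v X (leqnn K)) _.
by rewrite ler_piMr ?exprn_ge0 // exprn_ile1 // ltW.
Qed.

End Walks.

Section QuadraticForm.
Variables (R : realType) (m : nat) (V Ed : finType).
Variables (src dst : Ed -> V) (rev : Ed -> Ed) (lam : Ed -> {set 'I_m}).
Variables (q : Ed -> R) (rho : V -> R).
Hypotheses (revK : involutive rev) (src_rev : forall e, src (rev e) = dst e).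
Hypotheses (lam_rev : forall e, lam (rev e) = lam e).
Hypotheses (q_rev : forall e, q (rev e) = q e).
Hypotheses (rho_gt0 : forall v, 0 < rho v).

Definition quad_form (y : bits m) (f g : V -> R) : R :=
  \sum_e q e * chi R (lam e) y * f (src e) * g (dst e).

(** Degree normalisation: once [rho] dominates the degrees, the weights leaving a vertex add up to
    at most 1. The inner product [dot], weighted by [rho], keeps the step operator self-adjoint. *)
Let p e := q e / rho (src e).
Let W := \sum_v rho v.
Let dot (f g : V -> R) := \sum_v rho v * f v * g v.

Lemma dot_step y f g : dot f (signed_step src dst lam p y g) = quad_form y f g.
Proof.
rewrite /quad_form (partition_big src xpredT) //=; apply: eq_bigr => v _.
rewrite mulr_sumr; apply: eq_bigr => e /eqP <-.
rewrite /p; have := rho_gt0 (src e); move: (rho _) => r r0.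
by field; rewrite gt_eqF.
Qed.

Lemma quad_formC y f g : quad_form y f g = quad_form y g f.
Proof.
rewrite /quad_form (reindex_inj (inv_inj revK)); apply: eq_bigr => e _.
by rewrite lam_rev q_rev src_rev -(revK e) !src_rev revK; ring.
Qed.

Lemma dotC f g : dot f g = dot g f.
Proof. by apply: eq_bigr => v _; ring. Qed.

Lemma dot_iter y k l f g :
  dot (iter k (signed_step src dst lam p y) f) (iter l (signed_step src dst lam p y) g)
  = dot f (iter (k + l) (signed_step src dst lam p y) g).
Proof.
elim: k l => [|k IHk] l //.
by rewrite iterS dotC dot_step quad_formC -dot_step -iterS IHk addSnnS.
Qed.

Variables (y : bits m) (u : V -> R).
Hypothesis u1 : forall v, `|u v| <= 1.
Hypothesis W0 : 0 < W.

Let b k := dot u (iter k (signed_step src dst lam p y) u).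

Lemma sqr_dot_iter_le k :
  b k ^+ 2 <= W * \sum_v rho v * iter k (signed_step src dst lam p y) u v ^+ 2.
Proof.
apply: le_trans (sum_mulr_sqr_le _ _ (fun v => ltW (rho_gt0 v))) _.
apply: ler_wpM2r; first by apply: sumr_ge0 => v _; rewrite mulr_ge0 ?sqr_ge0 // ltW.
apply: ler_sum => v _; apply: ler_piMr; first exact: ltW.
by rewrite -real_normK ?num_real // expr_le1.
Qed.

(* Repeated squaring: [b (2^s) ^ 2 <= W * b (2^(s+1))] as the step operator is *)
(* self-adjoint for [dot].                                                     *)
Lemma quad_form_pow_le s :
  `|quad_form y u u| ^+ (2 ^ s) * W <= W ^+ (2 ^ s) * `|b (2 ^ s)|.
Proof.
elim: s => [|s IHs].
  by rewrite !expr1 mulrC /b -dot_step.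
rewrite expnS mulnC !exprM -(ler_pM2r W0).
apply: le_trans (_ : (W ^+ (2 ^ s) * `|b (2 ^ s)|) ^+ 2 <= _).
  rewrite -mulrA -expr2 -exprMn lerXn2r ?nnegrE ?mulr_ge0 ?exprn_ge0 ?normr_ge0 //; exact: ltW.
rewrite exprMn -[leRHS]mulrA; apply: ler_wpM2l; first by rewrite exprn_ge0 // exprn_ge0 // ltW.
rewrite real_normK ?num_real //; apply: le_trans (sqr_dot_iter_le _) _.
rewrite mulrC; apply: ler_wpM2r; first exact: ltW.
apply: le_trans _ (ler_norm _).
rewrite muln2 -addnn /b -dot_iter /dot le_eqVlt; apply/orP; left; apply/eqP.
by apply: eq_bigr => v _; rewrite expr2 mulrA.
Qed.

End QuadraticForm.

(** Repeated squaring reduces the moment to the [2 ^ s]-th power of the step operator. The vector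
    [u] may depend on [y], so it is first removed by Cauchy-Schwarz at the price of a factor [#|V|];
    what remains is bounded by [Ex_walk_poly_sqr]. *)
Lemma Ex_quad_form_le (R : realType) (m : nat) (V Ed : finType)
    (src dst : Ed -> V) (rev : Ed -> Ed) (lam : Ed -> {set 'I_m})
    (q : Ed -> R) (rho : V -> R) (c theta gamma : R) (s : nat)
    (D : distr R m) (u : bits m -> V -> R) :
  involutive rev -> (forall e, src (rev e) = dst e) ->
  (forall e, lam (rev e) = lam e) -> (forall e, q (rev e) = q e) ->
  (forall e, (#|lam e| <= 2)%N) ->
  (forall v, 0 < rho v) -> (0 < #|V|)%N ->
  0 < c -> c <= 1 -> 0 <= theta -> 0 <= gamma ->
  (forall v, \sum_(e | src e == v) `|q e| <= rho v) ->
  (forall v (X : {set 'I_m}), (#|X| <= 2 * 2 ^ s)%N ->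
    \sum_(e | src e == v) `|q e| * c ^+ #|symdiff X (lam e)|
      <= theta * rho v * c ^+ #|X|) ->
  biased gamma D -> (forall y v, `|u y v| <= 1) ->
  Ex D (fun y => `|quad_form src dst lam q y (u y) (u y)| ^+ (2 ^ s * 2))
    <= (\sum_v rho v) ^+ (2 ^ s * 2) * (#|V|%:R * (theta ^+ (2 ^ s) + gamma)).
Proof.
move=> revK src_rev lam_rev q_rev lam2 rho0 V0 c0 c1 theta0 gamma0 q1 contract bD u1.
set W := \sum_v rho v; set k := (2 ^ s)%N.
have W0 : 0 < W.
  case/card_gt0P: V0 => v _; rewrite /W (bigD1 v) //= ltr_pwDl ?sumr_ge0 // => *; exact: ltW.
set p := fun e => q e / rho (src e).
have pE e : `|p e| = `|q e| / rho (src e) by rewrite normrM normfV (gtr0_norm (rho0 _)).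
have p1 v : \sum_(e | src e == v) `|p e| <= 1.
  rewrite -(ler_pM2r (rho0 v)) mul1r; apply: le_trans (q1 v).
  by rewrite mulr_suml ler_sum // => e /eqP ev; rewrite pE ev mulfVK ?gt_eqF.
have pc v (X : {set 'I_m}) : (#|X| <= 2 * k)%N ->
    \sum_(e | src e == v) `|p e| * c ^+ #|symdiff X (lam e)| <= theta * c ^+ #|X|.
  move=> hX; rewrite -(ler_pM2r (rho0 v)) mulrAC; apply: le_trans (contract _ _ hX).
  by rewrite mulr_suml ler_sum // => e /eqP ev; rewrite pE ev mulrAC mulfVK ?gt_eqF.
have key y : `|quad_form src dst lam q y (u y) (u y)| ^+ (k * 2) <=
    W ^+ (k * 2) / W * (#|V|%:R * \sum_v rho v *
      \sum_v' walk_poly src dst lam p k v v' y ^+ 2).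
  have := quad_form_pow_le revK src_rev lam_rev q_rev rho0 y (u1 y) W0 s.
  rewrite -/k; set Q := `|quad_form _ _ _ _ _ _ _|; set B := `|_| => QB.
  have B2 : B ^+ 2 <= W * \sum_v rho v * (#|V|%:R * \sum_v' walk_poly src dst lam p k v v' y ^+ 2).
    rewrite /B real_normK ?num_real //; apply: le_trans (sqr_dot_iter_le src dst lam q rho0 y (u1 y) k) _.
    apply: ler_wpM2l; first exact: ltW.
    apply: ler_sum => v _; apply: ler_wpM2l; first exact: ltW.
    rewrite iter_signed_step.
    have := sum_mulr_sqr_le (u y) (fun v' => walk_poly src dst lam p k v v' y) (fun=> ler01 : 0 <= 1 :> R).
    under eq_bigr do rewrite mul1r mulrC.
    move=> h; apply: le_trans h _; apply: ler_pM.
    - by apply: sumr_ge0 => w _; rewrite mul1r sqr_ge0.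
    - by apply: sumr_ge0 => w _; rewrite mul1r sqr_ge0.
    - rewrite -sum1_card natr_sum; apply: ler_sum => w _; rewrite mul1r.
      by rewrite -real_normK ?num_real // expr_le1.
    - by apply: ler_sum => w _; rewrite mul1r.
  have QB2 : (Q ^+ k * W) ^+ 2 <= (W ^+ k * B) ^+ 2.
    rewrite lerXn2r ?nnegrE ?mulr_ge0 ?exprn_ge0 ?normr_ge0 //; exact: ltW.
  rewrite -(ler_pM2r (exprn_gt0 2 W0)) exprM -exprMn (le_trans QB2) //.
  rewrite exprMn exprM; set Y := \sum_v _.
  rewrite [leRHS](_ : _ = (W ^+ k) ^+ 2 * (W * (#|V|%:R * Y))); last by field; rewrite gt_eqF.
  apply: ler_wpM2l; first exact: sqr_ge0.
  apply: le_trans B2 _; apply: ler_wpM2l; first exact: ltW.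
  rewrite /Y.
  by rewrite mulr_sumr; apply: ler_sum => v _; rewrite mulrCA.
apply: le_trans (ler_Ex (fun y _ => key y)) _.
rewrite ExZ ExZ -mulrA; apply: ler_wpM2l; first by rewrite exprn_ge0 // ltW.
rewrite mulrCA; apply: ler_wpM2l; first exact: ler0n.
rewrite mulrC ler_pdivrMr // Ex_sum mulr_sumr; apply: ler_sum => v _.
rewrite ExZ mulrC; apply: ler_wpM2r; first exact: ltW.
exact: (Ex_walk_poly_sqr dst p1 lam2 c0 c1 theta0 pc v gamma0 bD).
Qed.

(** * Tail bounds for low-degree monomial sums *)

Lemma chi_pair (R : realType) (m : nat) (i j : 'I_m) (y : bits m) :
  i != j -> chi R [set i; j] y = (-1) ^+ y i * (-1) ^+ y j.
Proof. by move=> ij; rewrite /chi big_setU1 ?inE // big_set1. Qed.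

Section PairTail.
Variables (R : realType) (m : nat) (I TA TB : finType) (J : {set 'I_m}).
Variables (a : 'I_m -> I) (fA : 'I_m -> TA) (fB : 'I_m -> TB) (w : 'I_m -> R).
Variables (pad M delta eps c gamma : R) (s : nat) (D : distr R m).
Variables (alpha : bits m -> I -> R) (betaA : bits m -> TA -> R) (betaB : bits m -> TB -> R).

(** Class sizes are raised by [pad], so that small classes are not overweighted by the division by
    [deg]; [padM] caps the total raise at [M]. *)
Let deg i : R := #|[set j in J | a j == i]|%:R + pad.

Hypotheses (w1 : forall j, `|w j| <= 1) (alpha1 : forall y i, `|alpha y i| <= 1).
Hypotheses (betaA1 : forall y x, `|betaA y x| <= 1) (betaB1 : forall y x, `|betaB y x| <= 1).
Hypotheses (M0 : 0 < M) (JM : #|J|%:R <= M) (pad0 : 0 <= pad) (padM : pad * #|I|%:R <= M).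
Hypotheses (eps0 : 0 < eps) (delta0 : 0 <= delta) (c0 : 0 < c) (c1 : c <= 1).
Hypotheses (gamma0 : 0 <= gamma) (bD : biased gamma D).
Hypotheses (TA0 : (0 < #|TA|)%N) (TB0 : (0 < #|TB|)%N).
Hypothesis deg_ge : forall j, j \in J -> 1 <= eps ^+ 2 / 4 * deg (a j).
Hypothesis codegA_le : forall j x, j \in J ->
  #|[set j' in J | (a j' == a j) && (fA j' == x)]|%:R * (#|TA| * #|TB|)%:R
    <= delta * M * deg (a j).
Hypothesis codegB_le : forall j x, j \in J ->
  #|[set j' in J | (a j' == a j) && (fB j' == x)]|%:R * (#|TA| * #|TB|)%:R
    <= delta * M * deg (a j).
Hypothesis delta_le : (2 ^ s * 4)%:R * delta <= c ^+ 4.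

Let Ed : finType := ('I_m * 'I_m)%type.
Let V : finType := (TA * TB)%type.
Let ok (e : Ed) := [&& e.1 \in J, e.2 \in J, a e.1 == a e.2 & e.1 != e.2].
Let q (e : Ed) : R := if ok e then w e.1 * w e.2 / deg (a e.1) else 0.
(** The parts are crossed: each end takes its A part from one query and its B part from the other.
    Swapping the pair then reverses the edge, which makes the form symmetric. *)
Let src (e : Ed) : V := (fA e.1, fB e.2).
Let dst (e : Ed) : V := (fA e.2, fB e.1).
Let rev (e : Ed) : Ed := (e.2, e.1).
Let lam (e : Ed) : {set 'I_m} := [set e.1; e.2].
(** The floor [M / #|V|] is what the few edges touching a given label set are compared with; it adds
    only [M] to the total weight. *)
Let rho (v : V) : R := \sum_(e | src e == v) `|q e| + M / #|V|%:R.

Let deg_gt0 j : j \in J -> 0 < deg (a j).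
Proof.
move=> jJ; have := lt_le_trans ltr01 (deg_ge jJ).
by rewrite pmulr_rgt0 // divr_gt0 // exprn_gt0.
Qed.

Let V0 : (0 < #|V|)%N. Proof. by rewrite card_prod muln_gt0 TA0. Qed.

Let MV0 : 0 < M / #|V|%:R. Proof. by rewrite divr_gt0 // ltr0n. Qed.

Let norm_q_le e : ok e -> `|q e| <= (deg (a e.1))^-1.
Proof.
move=> oke; rewrite /q oke; case/and4P: oke => e1 _ _ _.
rewrite !normrM normfV (gtr0_norm (deg_gt0 e1)) ler_piMl ?invr_ge0 ?(ltW (deg_gt0 e1)) //.
by rewrite mulr_ile1.
Qed.

(* Walk steps along an edge carrying a label already in [X]. *)
Let sum_touch (T : finType) (f : 'I_m -> T) x (X : {set 'I_m}) :
  (forall j, j \in J ->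
    #|[set j' in J | (a j' == a j) && (f j' == x)]|%:R * (#|TA| * #|TB|)%:R
      <= delta * M * deg (a j)) ->
  \sum_j \sum_j' (if [&& j \in X, j \in J, j' \in J, a j' == a j & f j' == x]
                  then (deg (a j))^-1 else 0)
    <= #|X|%:R * (delta * (M / #|V|%:R)).
Proof.
move=> codeg_le; rewrite mulr_natl -sumr_const [leRHS]big_mkcond; apply: ler_sum => j _.
have [jX|jX] /= := boolP (j \in X); last by rewrite big1.
have [jJ|jJ] /= := boolP (j \in J); last first.
  by rewrite big1 // mulr_ge0 // ltW.
rewrite -big_mkcond /= sumr_const -[leLHS]mulr_natl ler_pdivrMr ?deg_gt0 //.
rewrite mulrA mulrAC ler_pdivlMr ?ltr0n // card_prod.
apply: le_trans (codeg_le j jJ); rewrite ler_wpM2r //.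
by rewrite ler_nat subset_leq_card //; apply/subsetP => j'; rewrite !inE.
Qed.

Let sum_touch1 v (X : {set 'I_m}) :
  \sum_(e | src e == v) (if e.1 \in X then `|q e| else 0)
    <= #|X|%:R * (delta * (M / #|V|%:R)).
Proof.
apply: le_trans (sum_touch X (fun j jJ => codegB_le v.2 jJ)).
rewrite pair_bigA big_mkcond /=; apply: ler_sum => e _.
case: (boolP (ok e)) => [oke|/negbTE nok]; last first.
  rewrite /q nok normr0 if_same if_same.
  by case: ifP => // /and5P[_ jJ _ _ _]; rewrite invr_ge0 ltW // deg_gt0.
case/and4P: (oke) => e1J e2J ea _.
case: eqP => [ev|_]; last first.
  by case: ifP => //; rewrite invr_ge0 ltW // deg_gt0.
rewrite e1J e2J eq_sym ea -ev /= eqxx !andbT; case: ifP => // _; exact: norm_q_le.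
Qed.

Let sum_touch2 v (X : {set 'I_m}) :
  \sum_(e | src e == v) (if e.2 \in X then `|q e| else 0)
    <= #|X|%:R * (delta * (M / #|V|%:R)).
Proof.
apply: le_trans (sum_touch X (fun j jJ => codegA_le v.1 jJ)).
rewrite exchange_big pair_bigA big_mkcond /=; apply: ler_sum => e _.
case: (boolP (ok e)) => [oke|/negbTE nok]; last first.
  rewrite /q nok normr0 if_same if_same.
  by case: ifP => // /and5P[_ jJ _ _ _]; rewrite invr_ge0 ltW // deg_gt0.
case/and4P: (oke) => e1J e2J /eqP ea _.
case: eqP => [ev|_]; last first.
  by case: ifP => //; rewrite invr_ge0 ltW // deg_gt0.
rewrite e1J e2J ea -ev /= !eqxx !andbT; case: ifP => // _.
by rewrite -ea; apply: norm_q_le.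
Qed.

(** An edge disjoint from [X] adds two labels and gains [c ^+ 2]. Any other edge loses at most
    [c ^- 2], but by [sum_touch1] and [sum_touch2] such edges have weight at most [2 * #|X| * delta]
    times the floor of [rho], which [delta_le] bounds by [c ^+ 4 * rho v]. *)
Let contract v (X : {set 'I_m}) : (#|X| <= 2 * 2 ^ s)%N ->
  \sum_(e | src e == v) `|q e| * c ^+ #|symdiff X (lam e)|
    <= 2 * c ^+ 2 * rho v * c ^+ #|X|.
Proof.
move=> hX; set x := c ^+ #|X|.
have x0 : 0 < x by rewrite exprn_gt0.
apply: le_trans (_ : \sum_(e | src e == v) (c ^+ 2 * x * `|q e| +
    x / c ^+ 2 * ((if e.1 \in X then `|q e| else 0)
                + (if e.2 \in X then `|q e| else 0))) <= _).
  apply: ler_sum => e _; have [oke|nok] := boolP (ok e); last first.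
    by rewrite /q (negbTE nok) normr0 !if_same mul0r !mulr0 addr0 mulr0 addr0.
  have [/andP[e1X e2X]|touch] := boolP ((e.1 \notin X) && (e.2 \notin X)).
    rewrite (negbTE e1X) (negbTE e2X) addr0 mulr0 addr0 mulrC ler_wpM2r //.
    rewrite card_symdiff_disjoint.
      by case/and4P: oke => _ _ _ e12; rewrite /lam cards2 e12 exprD mulrC.
    rewrite disjoint_sym; apply/pred0P => j; rewrite /= !inE.
    by apply/negP => /andP[/orP[]/eqP-> jX]; move: e1X e2X; rewrite jX.
  have : c ^+ #|symdiff X (lam e)| <= x / c ^+ 2.
    rewrite ler_pdivlMr ?exprn_gt0 // -exprD; apply: ler_wiXn2l => //; first exact: ltW.
    apply: leq_trans (card_symdiff_ge X (lam e)) _.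
    by rewrite leq_add2l /lam cards2; case: (_ != _).
  have n0 := normr_ge0 (q e); move: touch; set t := _ / _ => + /(ler_wpM2l n0) h.
  have t0 : 0 <= t by rewrite divr_ge0 // ltW // exprn_gt0.
  have tn : 0 <= t * `|q e| by rewrite mulr_ge0.
  have cn : 0 <= c ^+ 2 * x * `|q e| by rewrite !mulr_ge0 // ltW.
  rewrite negb_and !negbK => /orP[] ->; case: ifP => _; lra.
rewrite big_split /= -!mulr_sumr big_split /=.
have h1 : \sum_(e | src e == v) `|q e| <= rho v by rewrite /rho lerDl ltW.
have h2 : M / #|V|%:R <= rho v by rewrite /rho lerDr sumr_ge0.
have h3 := lerD (sum_touch1 v X) (sum_touch2 v X).
have -> : 2 * c ^+ 2 * rho v * x = c ^+ 2 * x * rho v + x / c ^+ 2 * (c ^+ 4 * rho v).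
  by field; rewrite gt_eqF.
apply: lerD; first by rewrite ler_wpM2l // mulr_ge0 ?ltW ?exprn_gt0.
apply: ler_wpM2l; first by rewrite divr_ge0 ?ltW ?exprn_gt0.
apply: le_trans h3 _; apply: le_trans (_ : (2 ^ s * 4)%:R * delta * (M / #|V|%:R) <= _).
  have -> (z r t : R) : z * (r * t) + z * (r * t) = (z + z) * r * t by ring.
  apply: ler_wpM2r; first exact: ltW.
  apply: ler_wpM2r => //.
  rewrite -natrD ler_nat; apply: leq_trans (leq_add hX hX) _.
  by rewrite -mulnDl mulnC.
by apply: ler_pM => //; [rewrite mulr_ge0 | exact: ltW].
Qed.

Let lam2 e : (#|lam e| <= 2)%N.
Proof. by rewrite /lam cards2; case: (_ != _). Qed.

Let rho_gt0 v : 0 < rho v.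
Proof. by rewrite /rho ltr_wpDl // sumr_ge0. Qed.

Let sum_deg_inv j : j \in J ->
  \sum_(j' in J | a j' == a j) (deg (a j))^-1 <= 1.
Proof.
move=> jJ; rewrite sumr_const -[leLHS]mulr_natl ler_pdivrMr ?deg_gt0 // mul1r.
rewrite /deg -[leLHS]addr0 lerD // ler_nat subset_leq_card //.
by apply/subsetP => j'; rewrite !inE.
Qed.

Let sum_rho_le : \sum_v rho v <= 2 * M.
Proof.
rewrite big_split /= sumr_const -[M / _ *+ _]mulr_natl mulrCA mulfV ?gt_eqF ?ltr0n //.
have -> : \sum_v \sum_(e | src e == v) `|q e| = \sum_e `|q e|.
  by rewrite [RHS](partition_big src xpredT).
rewrite mulr1 mulrDl mul1r lerD2r.
apply: le_trans JM; rewrite -sumr_const.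
apply: le_trans (_ : \sum_(j in J) \sum_(j' in J | a j' == a j) (deg (a j))^-1 <= _).
  rewrite pair_big_dep [leRHS]big_mkcond /=; apply: ler_sum => e _.
  case: (boolP (ok e)) => [oke|/negbTE nok].
    by case/and4P: (oke) => -> -> ea _; rewrite eq_sym ea; apply: norm_q_le.
  rewrite /q nok normr0; case: ifP => // /and3P[jJ _ _].
  by rewrite invr_ge0 ltW // deg_gt0.
by apply: ler_sum => j jJ; apply: sum_deg_inv.
Qed.

Let Z (y : bits m) : R := \sum_(j in J) w j * (-1) ^+ y j * alpha y (a j) * betaA y (fA j) * betaB y (fB j).
Let quad (y : bits m) : R := \sum_e q e * chi R (lam e) y * (betaA y (src e).1 * betaB y (src e).2)
  * (betaA y (dst e).1 * betaB y (dst e).2).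

(* Cauchy-Schwarz over the classes of [a]; [eps ^+ 2 / 4 * M] bounds the      *)
(* diagonal pairs [j = j'].                                                   *)
Let Z_sqr_le y : Z y ^+ 2 <= 2 * M * (eps ^+ 2 / 4 * M + quad y).
Proof.
pose z j := w j * (-1) ^+ y j * betaA y (fA j) * betaB y (fB j).
pose S i := \sum_(j in J | a j == i) z j.
have S0 i : deg i = 0 -> S i = 0.
  move=> di0; rewrite /S big1 // => j /andP[jJ /eqP ai].
  by move: (deg_gt0 jJ); rewrite ai di0 ltxx.
have deg0 i : 0 <= deg i by rewrite addr_ge0.
have -> : Z y = \sum_i deg i * alpha y i * (S i / deg i).
  rewrite /Z (partition_big a xpredT) //=; apply: eq_bigr => i _.
  transitivity (alpha y i * S i).
    by rewrite /S mulr_sumr; apply: eq_bigr => j /andP[_ /eqP <-]; rewrite /z; ring.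
  have [di0|di0] := eqVneq (deg i) 0; first by rewrite S0 // mulr0 mul0r mulr0.
  by rewrite mulrAC mulrCA mulfV // mulr1 mulrC.
apply: le_trans (sum_mulr_sqr_le _ _ deg0) _.
apply: ler_pM; [| | |].
- by apply: sumr_ge0 => i _; rewrite mulr_ge0 ?sqr_ge0.
- by apply: sumr_ge0 => i _; rewrite mulr_ge0 ?sqr_ge0.
- apply: le_trans (_ : \sum_i deg i <= _).
    apply: ler_sum => i _; apply: ler_piMr => //.
    by rewrite -real_normK ?num_real // expr_le1.
  rewrite big_split /= sumr_const -[pad *+ _]mulr_natr mulrDl mul1r lerD //.
  apply: le_trans JM; rewrite -natr_sum ler_nat -sum1_card (partition_big a xpredT) //=.
  by apply: leq_sum => i _; rewrite -sum1_card; apply: eq_leq; apply: eq_bigl => j; rewrite inE.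
have -> : \sum_i deg i * (S i / deg i) ^+ 2 =
    \sum_(j in J) \sum_(j' in J | a j' == a j) z j * z j' / deg (a j).
  transitivity (\sum_i \sum_(j in J | a j == i) z j * S (a j) / deg (a j)).
    apply: eq_bigr => i _.
    transitivity (S i * S i / deg i).
      have [di0|di0] := eqVneq (deg i) 0; first by rewrite S0 // !mul0r expr0n mulr0.
      by field.
    rewrite {1}/S !mulr_suml; apply: eq_bigr => j /andP[_ /eqP ->] //.
  rewrite -(partition_big a xpredT) //=; apply: eq_bigr => j _.
  by rewrite /S mulr_sumr mulr_suml.
apply: le_trans (_ : \sum_(j in J) (eps ^+ 2 / 4 +
   \sum_(j' in J | (a j' == a j) && (j' != j)) z j * z j' / deg (a j)) <= _).
  apply: ler_sum => j jJ; rewrite (bigD1 j) /= ?jJ ?eqxx //.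
  apply: lerD; last first.
    by rewrite le_eqVlt; apply/orP; left; apply/eqP; apply: eq_bigl => j'; rewrite andbA.
  rewrite ler_pdivrMr ?deg_gt0 //; apply: le_trans (deg_ge jJ).
  have zz : `|z j| <= 1.
    rewrite /z !normrM normrX normrN1 expr1n mulr1.
    by do 2![rewrite mulr_ile1 ?mulr_ge0 ?normr_ge0 //].
  by rewrite -expr2 -real_normK ?num_real // expr_le1.
rewrite big_split /= sumr_const -[eps ^+ 2 / 4 *+ _]mulr_natr; apply: lerD.
  by rewrite ler_wpM2l // divr_ge0 // sqr_ge0.
rewrite le_eqVlt; apply/orP; left; apply/eqP.
rewrite pair_big_dep big_mkcond; apply: eq_bigr => e _ /=.
rewrite /q /ok (eq_sym (a e.2)) (eq_sym e.2); case: ifP => [/and4P[_ _ _ ne]|_]; last by rewrite !mul0r.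
by rewrite chi_pair // /z; ring.
Qed.

(** Markov's inequality for a high moment of [quad]: by [Z_sqr_le], [|Z| >= eps * M] forces
    [quad >= eps ^+ 2 / 4 * M], while the total weight is at most [2 * M]. The ratio of the two is
    [8 / eps ^+ 2]. *)
Lemma pair_tail :
  Ex D (fun y => ((eps * M <= `|Z y|)%R)%:R) <=
  (8 / eps ^+ 2) ^+ (2 ^ s * 2) *
    ((#|TA| * #|TB|)%:R * ((2 * c ^+ 2) ^+ (2 ^ s) + gamma)).
Proof.
have quadE y : quad y = quad_form src dst lam q y
  (fun v => betaA y v.1 * betaB y v.2) (fun v => betaA y v.1 * betaB y v.2) by [].
have e2M : 0 < eps ^+ 2 / 4 * M by rewrite mulr_gt0 // divr_gt0 // exprn_gt0.
have e2 : 0 < eps ^+ 2 by rewrite exprn_gt0.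
set K := (2 ^ s * 2)%N.
apply: le_trans (_ : Ex D (fun y => (eps ^+ 2 / 4 * M) ^- K * `|quad y| ^+ K) <= _).
  apply: ler_Ex => y _; case: (boolP (eps * M <= `|Z y|)) => [big|_]; last first.
    by rewrite mulr0n mulr_ge0  ?invr_ge0 ?exprn_ge0 // ltW.
  have : (eps * M) ^+ 2 <= Z y ^+ 2.
    by rewrite -[leRHS]real_normK ?num_real // lerXn2r ?nnegrE ?mulr_ge0 // ltW.
  move=> /le_trans/(_ (Z_sqr_le y)) h.
  have : eps ^+ 2 / 4 * M <= quad y.
    have M2 : 0 < 2 * M by rewrite mulr_gt0.
    by rewrite -(ler_pM2l M2); lra.
  rewrite -exprVn -exprMn => hq; apply: exprn_ege1.
  by rewrite mulrC ler_pdivlMr // mul1r (le_trans hq) // ler_norm.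
rewrite ExZ.
have revK : involutive rev by case.
have lam_rev e : lam (rev e) = lam e by rewrite /lam setUC.
have q_rev e : q (rev e) = q e.
  rewrite /q /ok /rev /= (eq_sym (a e.2)) (eq_sym e.2) andbCA.
  by case: ifP => // /and4P[_ _ /eqP-> _]; rewrite [w e.2 * _]mulrC.
have h := Ex_quad_form_le revK (fun=> erefl _ : src (rev _) = dst _) lam_rev q_rev
  lam2 rho_gt0 V0 c0 c1 (mulr_ge0 (ler0n _ 2) (sqr_ge0 c)) gamma0 _ contract bD _.
have {h} := h (fun y v => betaA y v.1 * betaB y v.2).
rewrite -/K => h; have -> : (8 / eps ^+ 2) ^+ K = (eps ^+ 2 / 4 * M) ^- K * (2 * M) ^+ K.
  by rewrite -(exprVn (eps ^+ 2 / 4 * M)) -exprMn; congr (_ ^+ _); field; rewrite !gt_eqF.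
rewrite -[leRHS]mulrA; apply: ler_wpM2l.
  by rewrite invr_ge0 exprn_ge0 // ltW.
rewrite -card_prod; apply: le_trans (h _ _) _.
- by move=> v; rewrite /rho lerDl ltW.
- by move=> y v; rewrite normrM mulr_ile1.
apply: ler_wpM2r; first by rewrite mulr_ge0 // addr_ge0 // exprn_ge0 // mulr_ge0 // sqr_ge0.
apply: lerXn2r => //; rewrite nnegrE.
  by apply: sumr_ge0 => v _; apply: ltW.
by rewrite mulr_ge0 // ltW.
Qed.
End PairTail.

Section TensorTail.
Variables (R : realType) (m : nat) (M delta eps c gamma : R) (s : nat) (D : distr R m).
Hypotheses (M0 : 0 < M) (eps0 : 0 < eps) (delta0 : 0 < delta) (c0 : 0 < c) (c1 : c <= 1).
Hypotheses (gamma0 : 0 <= gamma) (bD : biased gamma D).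
Hypothesis delta_le : (2 ^ s * 4)%:R * delta <= c ^+ 4.
Hypothesis delta_eps : delta <= eps ^+ 2 / 4.

Let tail (n : nat) : R :=
  (8 / eps ^+ 2) ^+ (2 ^ s * 2) * (n%:R * ((2 * c ^+ 2) ^+ (2 ^ s) + gamma)).

(* When the classes of [(a, f)] are large, [(a, f)] itself can serve as the    *)
(* key for Cauchy-Schwarz, and only [g] is left on the vertices.               *)
Lemma heavy_tail (I T U : finType) (J : {set 'I_m}) (a : 'I_m -> I) (f : 'I_m -> T)
    (g : 'I_m -> U) (w : 'I_m -> R) (alpha : bits m -> I -> R)
    (betaf : bits m -> T -> R) (betag : bits m -> U -> R) :
  (forall j, `|w j| <= 1) -> (forall y i, `|alpha y i| <= 1) ->
  (forall y x, `|betaf y x| <= 1) -> (forall y x, `|betag y x| <= 1) ->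
  #|J|%:R <= M -> (0 < #|U|)%N -> #|U|%:R <= delta * M ->
  (forall j, j \in J ->
    delta^-1 <= #|[set j' in J | (a j' == a j) && (f j' == f j)]|%:R) ->
  Ex D (fun y => ((eps * M <= `|\sum_(j in J)
    w j * (-1) ^+ y j * alpha y (a j) * betaf y (f j) * betag y (g j)|)%R)%:R)
  <= tail #|U|.
Proof.
move=> w1 alpha1 f1 g1 JM U0 UM heavy.
have degE j : #|[set j' in J | (a j', f j') == (a j, f j)]|%:R + 0
    = #|[set j' in J | (a j' == a j) && (f j' == f j)]|%:R :> R.
  by rewrite addr0.
have := @pair_tail R m (I * T)%type U unit J (fun j => (a j, f j)) g (fun=> tt) w
  0 M delta eps c gamma s D (fun y it => alpha y it.1 * betaf y it.2) betag (fun _ _ => 1)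
  w1 _ g1 _ M0 JM (lexx 0) _ eps0 (ltW delta0) c0 c1 gamma0 bD U0 _ _ _ _ delta_le.
rewrite card_unit muln1 => h; apply: le_trans (h _ _ _ _ _ _ _) => {h}.
- apply: ler_Ex => y _; rewrite /=; set Z := \sum_(_ in _) _; set Z' := \sum_(_ in _) _.
  suff -> : Z = Z' by [].
  by apply: eq_bigr => j _; rewrite mulr1 !mulrA.
- by move=> y it; rewrite normrM mulr_ile1.
- by move=> y x; rewrite normr1.
- by rewrite mul0r ltW.
- by [].
- move=> j jJ; rewrite degE; apply: le_trans (_ : delta * delta^-1 <= _).
    by rewrite mulfV // gt_eqF.
  by apply: ler_pM; rewrite ?invr_ge0 ?(ltW delta0) //; apply: heavy.
- move=> j x jJ; rewrite degE mulrC; apply: ler_pM; rewrite ?ler0n //.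
  rewrite ler_nat subset_leq_card //; apply/subsetP => j'; rewrite !inE xpair_eqE.
  by case/and3P => -> ->.
- move=> j x jJ; rewrite degE mulrC; apply: ler_pM; rewrite ?ler0n //.
  rewrite ler_nat subset_leq_card //; apply/subsetP => j'; rewrite !inE xpair_eqE.
  by case/and3P => -> ->.
Qed.

(** Split [J] by the size of the classes of [(a, f)] and [(a, g)], with threshold [delta^-1].
    Queries in a large class are handled by [heavy_tail]. For the others all codegrees are small,
    and [pair_tail] applies with key [a] and padding [M / #|I|]. A sum of three parts exceeds
    [3 * (eps * M)] only if one part exceeds [eps * M]. *)
Lemma tensor_tail (I T U : finType) (J : {set 'I_m}) (a : 'I_m -> I) (f : 'I_m -> T)
    (g : 'I_m -> U) (w : 'I_m -> R) (alpha : bits m -> I -> R)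
    (betaf : bits m -> T -> R) (betag : bits m -> U -> R) :
  (forall j, `|w j| <= 1) -> (forall y i, `|alpha y i| <= 1) ->
  (forall y x, `|betaf y x| <= 1) -> (forall y x, `|betag y x| <= 1) ->
  #|J|%:R <= M -> (0 < #|I|)%N -> (0 < #|T|)%N -> (0 < #|U|)%N ->
  #|I|%:R <= delta * M -> #|T|%:R <= delta * M -> #|U|%:R <= delta * M ->
  (#|I| * (#|T| * #|U|))%:R <= (delta * M) ^+ 2 ->
  Ex D (fun y => ((3 * (eps * M) <= `|\sum_(j in J)
    w j * (-1) ^+ y j * alpha y (a j) * betaf y (f j) * betag y (g j)|)%R)%:R)
  <= 3 * tail (#|T| * #|U|).
Proof.
move=> w1 alpha1 f1 g1 JM I0 T0 U0 IM TM UM ITU.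
pose codegf (K : {set 'I_m}) j : R := #|[set j' in K | (a j' == a j) && (f j' == f j)]|%:R.
pose codegg (K : {set 'I_m}) j : R := #|[set j' in K | (a j' == a j) && (g j' == g j)]|%:R.
pose J1 := [set j in J | delta^-1 <= codegf J j].
pose J2 := [set j in J | delta^-1 <= codegg J j].
pose J3 := (J :\: J1) :\: J2.
have J1J : J1 \subset J by apply/subsetP => j; rewrite inE => /andP[].
have J2J : J2 \subset J by apply/subsetP => j; rewrite inE => /andP[].
have J3J : J3 \subset J by apply/subsetP => j; rewrite !inE => /and3P[].
have leM (K : {set 'I_m}) : K \subset J -> #|K|%:R <= M.
  by move=> KJ; apply: le_trans JM; rewrite ler_nat subset_leq_card.
(* [J1] and [J2] overlap: [w2] avoids counting the overlap twice. *)
pose w2 j := if j \in J1 then 0 else w j.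
have w21 j : `|w2 j| <= 1 by rewrite /w2; case: ifP; rewrite ?normr0.
pose z (y : bits m) j : R := w j * (-1) ^+ y j * alpha y (a j) * betaf y (f j) * betag y (g j).
pose Z1 (y : bits m) : R := \sum_(j in J1) w j * (-1) ^+ y j * alpha y (a j) * betaf y (f j) * betag y (g j).
pose Z2 (y : bits m) : R := \sum_(j in J2) w2 j * (-1) ^+ y j * alpha y (a j) * betag y (g j) * betaf y (f j).
pose Z3 (y : bits m) : R := \sum_(j in J3) w j * (-1) ^+ y j * alpha y (a j) * betaf y (f j) * betag y (g j).
have ZE y : \sum_(j in J) z y j = Z1 y + Z2 y + Z3 y.
  rewrite -addrA (big_setID J1) /= (setIidPr J1J); congr (_ + _).
  rewrite (big_setID J2) /=; congr (_ + _).
  have -> : Z2 y = \sum_(j in J2 :\: J1) z y j.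
    rewrite /Z2 (big_setID J1) /= big1 ?add0r => [|j /setIP[_ jJ1]]; last first.
      by rewrite /w2 jJ1 !mul0r.
    by apply: eq_bigr => j /setDP[_ jJ1]; rewrite /w2 (negbTE jJ1) /z; ring.
  apply: eq_bigl => j; have := subsetP J2J j.
  by rewrite !in_setI !in_setD; case: (j \in J2) => [->|]; rewrite ?andbF ?andbT.
have tail_le n n' : (n <= n')%N -> tail n <= tail n'.
  move=> nn; rewrite /tail; apply: ler_wpM2l.
    by rewrite exprn_ge0 // divr_ge0 // sqr_ge0.
  apply: ler_wpM2r; last by rewrite ler_nat.
  by rewrite addr_ge0 // exprn_ge0 // mulr_ge0 // sqr_ge0.
have t1 : Ex D (fun y => ((eps * M <= `|Z1 y|)%R)%:R) <= tail (#|T| * #|U|).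
  apply: le_trans (tail_le #|U| _ _); last by rewrite leq_pmull.
  apply: heavy_tail => //; first exact: leM.
  move=> j; rewrite inE => /andP[jJ hj]; apply: le_trans (hj) _.
  rewrite ler_nat subset_leq_card //; apply/subsetP => j'; rewrite !inE.
  case/and3P => j'J /eqP aj /eqP fj; rewrite j'J aj fj !eqxx /= andbT.
  by rewrite /codegf aj fj.
have t2 : Ex D (fun y => ((eps * M <= `|Z2 y|)%R)%:R) <= tail (#|T| * #|U|).
  apply: le_trans (tail_le #|T| _ _); last by rewrite leq_pmulr.
  apply: heavy_tail => //; first exact: leM.
  move=> j; rewrite inE => /andP[jJ hj]; apply: le_trans (hj) _.
  rewrite ler_nat subset_leq_card //; apply/subsetP => j'; rewrite !inE.
  case/and3P => j'J /eqP aj /eqP fj; rewrite j'J aj fj !eqxx /= andbT.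
  by rewrite /codegg aj fj.
have I0R : 0 < #|I|%:R :> R by rewrite ltr0n.
(* A codegree of at most [delta^-1] is affordable against the padding alone, by the bound on
   [#|I| * (#|T| * #|U|)]. *)
have light (l : nat) d : l%:R <= delta^-1 -> 0 <= d ->
    l%:R * (#|T| * #|U|)%:R <= delta * M * (d + M / #|I|%:R).
  move=> hc hd; apply: le_trans (_ : delta * M * (M / #|I|%:R) <= _); last first.
    by apply: ler_wpM2l; rewrite ?lerDr //; apply: mulr_ge0; exact: ltW.
  rewrite mulrA ler_pdivlMr // -[leLHS]mulrA -natrM [(_ * #|I|)%N]mulnC.
  apply: le_trans (_ : delta^-1 * (delta * M) ^+ 2 <= _); last first.
    by rewrite expr2 -mulrA mulKf ?gt_eqF // mulrCA mulrA.
  by apply: ler_pM; rewrite ?ler0n.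
have lightf j x : #|[set j' in J3 | (a j' == a j) && (f j' == x)]|%:R <= delta^-1.
  have [->|[j0]] := set_0Vmem [set j' in J3 | (a j' == a j) && (f j' == x)].
    by rewrite cards0 invr_ge0 ltW.
  rewrite inE => /and3P[j0J3 /eqP <- /eqP <-].
  move: (j0J3); rewrite !inE => /and3P[_ j0J1 j0J]; move: j0J1.
  rewrite j0J -ltNge => /ltW; apply: le_trans.
  rewrite ler_nat subset_leq_card //; apply/subsetP => j'; rewrite inE => /andP[j'J3 h].
  by rewrite inE h (subsetP J3J).
have lightg j x : #|[set j' in J3 | (a j' == a j) && (g j' == x)]|%:R <= delta^-1.
  have [->|[j0]] := set_0Vmem [set j' in J3 | (a j' == a j) && (g j' == x)].
    by rewrite cards0 invr_ge0 ltW.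
  rewrite inE => /and3P[j0J3 /eqP <- /eqP <-].
  move: (j0J3); rewrite !inE => /and3P[j0J2 _ j0J]; move: j0J2.
  rewrite j0J -ltNge => /ltW; apply: le_trans.
  rewrite ler_nat subset_leq_card //; apply/subsetP => j'; rewrite inE => /andP[j'J3 h].
  by rewrite inE h (subsetP J3J).
have t3 : Ex D (fun y => ((eps * M <= `|Z3 y|)%R)%:R) <= tail (#|T| * #|U|).
  apply: (@pair_tail R m I T U J3 a f g w (M / #|I|%:R) M delta eps c gamma s D) => //.
  - exact: leM.
  - by rewrite divr_ge0 // ltW.
  - by rewrite mulfVK ?gt_eqF.
  - exact: ltW.
  - move=> j _; apply: le_trans (_ : delta * (M / #|I|%:R) <= _).
      by rewrite mulrA ler_pdivlMr // mul1r.
    by apply: ler_pM; rewrite ?lerDr ?ler0n ?(ltW delta0) // divr_ge0 // ltW.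
  - by move=> j x _; apply: light; rewrite ?ler0n.
  - by move=> j x _; apply: light; rewrite ?ler0n.
apply: le_trans (_ : Ex D (fun y => ((eps * M <= `|Z1 y|)%R)%:R +
  ((eps * M <= `|Z2 y|)%R)%:R + ((eps * M <= `|Z3 y|)%R)%:R) <= _).
  apply: ler_Ex => y _; have := ZE y; rewrite /z => ->.
  case: (leP (eps * M) `|Z1 y|) => h1; case: (leP (eps * M) `|Z2 y|) => h2;
  case: (leP (eps * M) `|Z3 y|) => h3;
  case: (leP (3 * (eps * M)) `|Z1 y + Z2 y + Z3 y|) => h4 /=; try lra.
  have := ler_normD (Z1 y + Z2 y) (Z3 y); have := ler_normD (Z1 y) (Z2 y); lra.
rewrite /Ex; under eq_bigr do rewrite !mulrDr.
rewrite !big_split /=; move: t1 t2 t3; rewrite /Ex; lra.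
Qed.
End TensorTail.

(** * Fourier expansion and low-degree correlation *)

Section Fourier.
Variables (R : realType) (t : nat).
Implicit Types (G : bits t -> bool) (x z : bits t) (T : {set 'I_t}).

Definition fourier G T : R := (2 ^+ t)^-1 * \sum_x (-1) ^+ G x * chi R T x.

Let two_neq0 : 2 ^+ t != 0 :> R. Proof. by rewrite expf_neq0 // pnatr_eq0. Qed.

Let card_bits : #|bits t|%:R = 2 ^+ t :> R.
Proof. by rewrite card_ffun card_bool card_ord natrX. Qed.

(** The sum factors over coordinates into [1 + (-1)^(x j + z j)], which vanishes at any coordinate
    where [x] and [z] differ. *)
Lemma sum_chi_mul x z : \sum_T chi R T x * chi R T z = (x == z)%:R * 2 ^+ t.
Proof.
transitivity (\prod_j ((-1) ^+ x j * (-1) ^+ z j + 1) : R).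
  rewrite bigA_distr; apply: eq_bigr => T _.
  rewrite /chi -big_split /= [RHS]big_mkcond /=.
  by rewrite big_mkcond; apply: eq_bigr => j _; case: (j \in T).
have [->|xz] := eqVneq x z.
  rewrite mul1r -[X in _ ^+ X]card_ord -prodr_const; apply: eq_bigr => j _.
  by case: (z j); rewrite /= ?mulrNN mulr1.
have [j xzj] : exists j, x j != z j.
  apply/existsP; rewrite -negb_forall; apply: contra xz => /forallP xz.
  by apply/eqP/ffunP => j; apply/eqP.
rewrite (bigD1 j) //= mul0r; move: xzj.
by case: (x j); case: (z j) => //= _; rewrite ?mulr1 ?mul1r addNr mul0r.
Qed.

Lemma fourier_inversion G x : \sum_T fourier G T * chi R T x = (-1) ^+ G x.
Proof.
transitivity ((2 ^+ t)^-1 * \sum_z (-1) ^+ G z * \sum_T chi R T z * chi R T x).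
  rewrite mulr_sumr; under [RHS]eq_bigr do rewrite !mulr_sumr.
  rewrite exchange_big; apply: eq_bigr => T _ /=.
  by rewrite /fourier mulr_sumr mulr_suml; apply: eq_bigr => z _; ring.
rewrite (bigD1 x) //= sum_chi_mul eqxx mul1r big1 ?addr0 => [|z zx].
  by rewrite mulrCA mulVf ?mulr1.
by rewrite sum_chi_mul (negbTE zx) mul0r mulr0.
Qed.

Lemma normr_fourier_le1 G T : `|fourier G T| <= 1.
Proof.
rewrite normrM gtr0_norm ?invr_gt0 ?exprn_gt0 // mulrC ler_pdivrMr ?exprn_gt0 // mul1r.
apply: le_trans (ler_norm_sum _ _ _) _; rewrite -card_bits -sumr_const.
by apply: ler_sum => x _; rewrite normrM normr_chi normrX normrN1 expr1n mulr1.
Qed.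

Definition is_full_parity G :=
  [exists b : bool, [forall x, G x == b (+) parity [set: 'I_t] x]].

Lemma sum_sign_le (f : bits t -> bool) :
  (exists x, f x) -> \sum_x (-1) ^+ f x <= 2 ^+ t - 2 :> R.
Proof.
case=> x fx; have <- : (\sum_(i : bits t) 1) - 2 = 2 ^+ t - 2 :> R.
  by rewrite sumr_const card_bits.
rewrite (bigD1 x) // [in leRHS](bigD1 x) //= fx expr1.
have : \sum_(i | i != x) (-1) ^+ f i <= \sum_(i : bits t | i != x) 1 :> R.
  by apply: ler_sum => z _; case: (f z); rewrite /= ?expr0 ?expr1 //; lra.
lra.
Qed.

(** As [G] is neither the parity nor its negation, both signs occur among the [2 ^ t] terms, and a
    single deviating term costs 2 in either direction. *)
Lemma normr_fourier_setT_le G : ~~ is_full_parity G ->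
  `|fourier G [set: 'I_t]| <= 1 - 2 / 2 ^+ t.
Proof.
rewrite negb_exists => /forallP nG.
have ex b : exists x, G x (+) parity [set: 'I_t] x == ~~ b.
  have := nG b; rewrite negb_forall => /existsP[x Gx]; exists x; move: Gx.
  by case: (G x); case: b; case: (parity _ x).
pose f x := G x (+) parity [set: 'I_t] x.
rewrite normrM gtr0_norm ?invr_gt0 ?exprn_gt0 // mulrC ler_pdivrMr ?exprn_gt0 //.
rewrite mulrBl mul1r mulfVK //.
have -> : \sum_x (-1) ^+ G x * chi R [set: 'I_t] x = \sum_x (-1) ^+ f x.
  by apply: eq_bigr => x _; rewrite chi_parity -signr_addb.
have := sum_sign_le (f := f); have := sum_sign_le (f := fun x => ~~ f x).
have -> : \sum_x (-1) ^+ (~~ f x) = - \sum_x (-1) ^+ f x :> R.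
  by rewrite -sumrN; apply: eq_bigr => x _; rewrite signrN.
have ex1 : exists x, ~~ f x by have [x /eqP fx] := ex true; exists x; rewrite /f fx.
have ex2 : exists x, f x by have [x /eqP fx] := ex false; exists x; rewrite /f fx.
by move=> /(_ ex1) h1 /(_ ex2) h2; rewrite ler_norml; lra.
Qed.

(** The full expansion has correlation exactly 1 with [G] at each point; dropping the top term loses
    at most [1 - 2 / 2 ^+ t]. *)
Lemma low_degree_correlation G x : ~~ is_full_parity G ->
  2 / 2 ^+ t <= (-1) ^+ G x * \sum_(T | T != [set: 'I_t]) fourier G T * chi R T x.
Proof.
move=> nG; have := fourier_inversion G x; rewrite (bigD1 [set: 'I_t]) //=.
set F := fourier _ _ * _; set L := \sum_(_ | _) _ => FL.
have Fle : `|F| <= 1 - 2 / 2 ^+ t by rewrite normrM normr_chi mulr1 normr_fourier_setT_le.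
have -> : L = (-1) ^+ G x - F by rewrite -FL [F + L]addrC addrK.
move: Fle; rewrite ler_norml; case: (G x); rewrite /= ?expr1 ?expr0; lra.
Qed.

End Fourier.

(** * Independence of the answers under small bias *)

Section Independence.
Variables (R : realType) (m n t : nat) (gamma : R) (D : distr R m).
Variables (q : 'I_m -> 'I_t -> 'I_n) (G : 'I_m -> bits t -> bool).
Hypotheses (gamma1 : gamma < 1) (bD : biased gamma D).
Hypothesis rep : forall y, D y != 0 ->
  exists E : bits n, forall j, y j = G j [ffun i => E (q j i)].

(** A constant character would have an expectation of modulus 1, above the bias. *)
Lemma no_constant_chi (X : {set 'I_m}) (b : R) :
  X != set0 -> ~ (forall y, D y != 0 -> chi R X y = b).
Proof.
move=> X0 chib; have := biased_Ex_chi bD X0.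
have ExE (f g : bits m -> R) : (forall y, D y != 0 -> f y = g y) -> Ex D f = Ex D g.
  by move=> fg; apply/le_anti/andP; split; apply: ler_Ex => y /fg ->.
have b1 : `|b| * `|b| = 1.
  rewrite -normrM -(Ex_cst D (b * b)) -[RHS]normr1; congr `|_|.
  rewrite -[RHS](Ex_cst D); apply: ExE => y /chib <-; exact: chi_sqr.
rewrite (ExE _ (fun=> b)) // Ex_cst; have := normr_ge0 b.
by move: gamma1 b1; nra.
Qed.

Lemma pigeonhole (T : finType) (Phi : {set 'I_m} -> T) (K : {set 'I_m}) :
  (#|T| < 2 ^ #|K|)%N ->
  exists I I' : {set 'I_m}, [/\ I \subset K, I' \subset K, I != I' & Phi I = Phi I'].
Proof.
move=> TK; have [inj|/dinjectivePn] := boolP (dinjectiveb Phi (mem (powerset K))).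
  move: TK; rewrite -card_powerset -(card_in_imset (dinjectiveP _ _ inj)).
  by rewrite ltnNge max_card.
case=> I; rewrite powersetE => IK [I']; rewrite !inE /= => /andP[I'I I'K] PhiE.
by exists I, I'; split; rewrite // eq_sym.
Qed.

Lemma no_collision (I I' : {set 'I_m}) :
  (exists b, forall E : bits n,
    chi R I [ffun j => G j [ffun i => E (q j i)]] *
    chi R I' [ffun j => G j [ffun i => E (q j i)]] = b) -> I = I'.
Proof.
case=> b chib; apply/eqP; rewrite -symdiff_eq0; apply/negPn/negP => X0.
apply: (no_constant_chi (b := b) X0) => y /rep[E yE].
rewrite -chiM -(chib E).
by have -> : y = [ffun j => G j [ffun i => E (q j i)]] by apply/ffunP => j; rewrite ffunE yE.
Qed.

(** Each set of queries yields a parity function of the memory. There are [2 ^ m] sets and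
    [2 ^ (2 ^ n)] functions, and [no_collision] forbids a coincidence. This settles the range of
    bounded space. *)
Lemma queries_le_exp : (m <= 2 ^ n)%N.
Proof.
pose Phi (I : {set 'I_m}) : {ffun bits n -> bool} :=
  [ffun E : bits n => parity I [ffun j => G j [ffun i => E (q j i)]]].
rewrite leqNgt; apply/negP => nm.
have [|I [I' [_ _ /eqP II' PhiE]]] := pigeonhole Phi (K := [set: 'I_m]).
  by rewrite !card_ffun card_bool card_ord cardsT card_ord ltn_exp2l.
apply: II'; apply: no_collision; exists 1 => E.
move/ffunP/(_ E): PhiE; rewrite !ffunE => PE.
by rewrite !chi_parity PE -expr2 sqrr_sign.
Qed.

(** Up to sign these answers are linear forms in [n] bits, and more than [n] linear forms are
    dependent over the field with two elements. *)
Lemma card_full_parity_le : (#|[set j | is_full_parity (G j)]| <= n)%N.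
Proof.
set K := [set j | _].
pose A (E : bits n) : bits m := [ffun j => parity [set: 'I_t] [ffun i => E (q j i)]].
(* The coefficient vector of the sum of the linear forms in [I], read off at the unit vectors. *)
pose Phi (I : {set 'I_m}) : bits n := [ffun k => parity I (A [ffun k' => k' == k])].
have linA (I : {set 'I_m}) (E : bits n) : parity I (A E) = \big[addb/false]_k (E k && Phi I k).
  transitivity (\big[addb/false]_(j in I) \big[addb/false]_i \big[addb/false]_k
      (E k && (q j i == k))).
    apply: eq_bigr => j _; rewrite ffunE /parity.
    apply: eq_big => [i|i _]; first by rewrite inE.
    rewrite ffunE (bigD1 (q j i)) //= eqxx andbT big1 ?addbF // => k /negbTE.
    by rewrite eq_sym => ->; rewrite andbF.
  under eq_bigr do rewrite exchange_big.
  rewrite exchange_big; apply: eq_bigr => k _ /=.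
  rewrite ffunE /parity big_distrr; apply: eq_bigr => j _ /=.
  rewrite ffunE /parity big_distrr /=; apply: eq_big => [i|i _]; first by rewrite inE.
  by rewrite !ffunE.
rewrite leqNgt; apply/negP => nK.
have [|I [I' [IK I'K /eqP II' PhiE]]] := pigeonhole Phi (K := K).
  by rewrite card_ffun card_bool card_ord ltn_exp2l.
have Gb j : exists b, j \in K -> forall x, G j x = b (+) parity [set: 'I_t] x.
  have [jK|_] := boolP (j \in K); last by exists false.
  move: jK; rewrite inE => /existsP[b /forallP Gb]; exists b => _ x; exact/eqP.
have [b bE] := fin_all_exists Gb.
have chiE (L : {set 'I_m}) (E : bits n) : L \subset K -> chi R L [ffun j => G j [ffun i => E (q j i)]]
    = (-1) ^+ (parity L [ffun j => b j]) * (-1) ^+ (\big[addb/false]_k (E k && Phi L k)).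
  move=> LK; rewrite -!linA -!chi_parity /chi -big_split /=; apply: eq_bigr => j jL.
  by rewrite !ffunE (bE _ (subsetP LK _ jL)) signr_addb.
apply: II'; apply: no_collision.
exists ((-1) ^+ (parity I [ffun j => b j]) * (-1) ^+ (parity I' [ffun j => b j])) => E.
by rewrite !chiE // PhiE mulrACA -!expr2 sqrr_sign mulr1.
Qed.

End Independence.

(** * The bound on the number of queries *)

Section LowDegree.
Variables (R : realType) (m n kA kB : nat) (D : distr R m).
Let t := (kA + kB).+2.
Variables (q : 'I_m -> 'I_t -> 'I_n) (G : 'I_m -> bits t -> bool).
Hypothesis rep : forall y, D y != 0 ->
  exists E : bits n, forall j, y j = G j [ffun i => E (q j i)].

Let J := [set j | ~~ is_full_parity (G j)].

(** A chosen memory string explaining [y], which turns the characters of the memory into functions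
    of the answers. Under [rep], the default is reached only at points of probability 0. *)
Definition source (y : bits m) : bits n :=
  odflt [ffun=> false] [pick E : bits n | [forall j, y j == G j [ffun i => E (q j i)]]].

Lemma sourceP y j : D y != 0 -> y j = G j [ffun i => source y (q j i)].
Proof.
move=> /rep[E yE]; rewrite /source; case: pickP => [E' /forallP/(_ j)/eqP //|/(_ E)].
by move=> /forallP[] j'; apply/eqP.
Qed.

Definition monomial_sum T (y : bits m) : R :=
  \sum_(j in J) fourier R (G j) T * (-1) ^+ y j * chi R T [ffun i => source y (q j i)].

Lemma sum_monomial_sum_ge y : D y != 0 ->
  #|J|%:R * (2 / 2 ^+ t) <= \sum_(T | T != [set: 'I_t]) monomial_sum T y.
Proof.
move=> Dy; rewrite exchange_big mulr_natl -sumr_const; apply: ler_sum => j.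
rewrite inE => nG; apply: le_trans (low_degree_correlation R [ffun i => source y (q j i)] nG) _.
rewrite mulr_sumr le_eqVlt; apply/orP; left; apply/eqP; apply: eq_bigr => T _.
by rewrite -(sourceP j Dy) mulrA [_ * fourier R _ _]mulrC.
Qed.

(** [T] misses some probe [p]. Of the other [t - 1] probes one is the key and the rest form two
    blocks of [kA] and [kB], to which [tensor_tail] applies. Probes outside [T] contribute the
    factor 1, so all types are treated alike. *)
Lemma monomial_tail T (M delta eps c gamma : R) s :
  T != [set: 'I_t] ->
  0 < M -> 0 < eps -> 0 < delta -> 0 < c -> c <= 1 -> 0 <= gamma -> biased gamma D ->
  (2 ^ s * 4)%:R * delta <= c ^+ 4 -> delta <= eps ^+ 2 / 4 -> #|J|%:R <= M ->
  (0 < n)%N -> n%:R <= delta * M ->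
  (n ^ kA)%:R <= delta * M -> (n ^ kB)%:R <= delta * M ->
  (n ^ (kA + kB).+1)%:R <= (delta * M) ^+ 2 ->
  Ex D (fun y => ((3 * (eps * M) <= `|monomial_sum T y|)%R)%:R) <=
  3 * ((8 / eps ^+ 2) ^+ (2 ^ s * 2) *
       ((n ^ (kA + kB))%:R * ((2 * c ^+ 2) ^+ (2 ^ s) + gamma))).
Proof.
move=> TT M0 eps0 delta0 c0 c1 gamma0 bD d1 d2 JM n0 nM AM BM ABM.
have [p pT] : exists p, p \notin T.
  apply/existsP; rewrite -negb_forall; apply: contra TT => /forallP TT.
  by apply/eqP/setP => i; rewrite inE TT.
pose phi y (i : 'I_(kA + kB).+1) k : R := if lift p i \in T then (-1) ^+ source y k else 1.
have phi1 y i k : `|phi y i k| = 1.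
  by rewrite /phi; case: ifP => _; rewrite ?normrX ?normrN1 ?expr1n ?normr1.
pose fA j : {ffun 'I_kA -> 'I_n} := [ffun i => q j (lift p (lift ord0 (lshift kB i)))].
pose fB j : {ffun 'I_kB -> 'I_n} := [ffun i => q j (lift p (lift ord0 (rshift kA i)))].
have := @tensor_tail R m M delta eps c gamma s D M0 eps0 delta0 c0 c1 gamma0 bD d1 d2
  'I_n {ffun 'I_kA -> 'I_n} {ffun 'I_kB -> 'I_n} J (fun j => q j (lift p ord0)) fA fB
  (fun j => fourier R (G j) T) (fun y => phi y ord0)
  (fun y x => \prod_i phi y (lift ord0 (lshift kB i)) (x i))
  (fun y x => \prod_i phi y (lift ord0 (rshift kA i)) (x i)).
rewrite !card_ffun !card_ord -expnD -expnS !expn_gt0 n0 => h.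
apply: le_trans (h _ _ _ _ JM _ _ _ nM AM BM _) => //.
- apply: ler_Ex => y _; rewrite /monomial_sum.
  set Z := \sum_(_ in _) _; set Z' := \sum_(_ in _) _; suff -> : Z = Z' by [].
  apply: eq_bigr => j _; rewrite -!mulrA; congr (_ * (_ * _)).
  rewrite /chi big_mkcond (bigD1_ord p) //= (negbTE pT) mul1r big_ord_recl.
  rewrite /phi ffunE big_split_ord /=; congr (_ * (_ * _)).
  by congr (_ * _); apply: eq_bigr => i _; rewrite !ffunE.
- by move=> j; apply: normr_fourier_le1.
- by move=> y i; rewrite phi1.
- by move=> y x; rewrite normr_prod big1.
- by move=> y x; rewrite normr_prod big1.
Qed.

(* [2^(8t+14)] is the square of [8 / eps ^+ 2] for [eps = 2^-(2t+2)], the      *)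
(* fraction of the total correlation carried by one third of one monomial;   *)
(* [c] is small enough for [(2 c^2)^(2^s)] to beat [n^-t].                     *)
Lemma queries_lt (s : nat) (gamma : R) (c := 2 ^- (t * (8 * t + 14)).+1 : R) :
  (kA <= kB.+1)%N -> (kB <= kA)%N -> (0 < kA)%N -> (0 < n)%N ->
  0 <= gamma -> gamma <= n%:R ^- t -> biased gamma D ->
  ((2 ^ (8 * t + 14)) ^ 2 ^ s <= n)%N -> (n < (2 ^ (8 * t + 14)) ^ (2 ^ s * 2))%N ->
  (6 * 2 ^ t < n)%N -> (0 < m)%N -> (m <= 2 * #|J|)%N ->
  (c ^+ 4 / (2 ^ s * 4)%:R * m%:R) ^+ 2 < (n ^ (kA + kB).+1)%:R.
Proof.
move=> kAB kBA kA0 n0 gamma0 gamman bD sn ns tn m0 mJ.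
set delta := c ^+ 4 / _; rewrite ltNge; apply/negP => mbig.
pose eps : R := 2 ^- (2 * t + 2).
have eps0 : 0 < eps by rewrite invr_gt0 exprn_gt0.
have c0 : 0 < c by rewrite invr_gt0 exprn_gt0.
have c1 : c <= 1 by rewrite invf_le1 ?exprn_gt0 // exprn_ege1 // ler1n.
have k0 : 0 < (2 ^ s * 4)%:R :> R by rewrite ltr0n muln_gt0 expn_gt0.
have delta0 : 0 < delta by rewrite divr_gt0 // exprn_gt0.
have mR0 : 0 < m%:R :> R by rewrite ltr0n.
have d1 : (2 ^ s * 4)%:R * delta <= c ^+ 4 by rewrite /delta mulrCA mulfV ?mulr1 // gt_eqF.
have d2 : delta <= eps ^+ 2 / 4.
  apply: ler_pM; rewrite ?invr_ge0 ?exprn_ge0 ?(ltW c0) ?(ltW k0) //.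
    rewrite /c /eps !exprVn -!exprM lef_pV2 ?posrE ?exprn_gt0 // ler_eXn2l ?ltr1n //.
    have : (t <= t * (8 * t + 14))%N by rewrite leq_pmulr ?addnS.
    by move: (t * _)%N; clear; move: t; lia.
  by rewrite lef_pV2 ?posrE // ler_nat leq_pmull // expn_gt0.
have JM : #|J|%:R <= m%:R :> R by rewrite ler_nat -[leqRHS](card_ord m) max_card.
have dm0 : 0 <= delta * m%:R by rewrite mulr_ge0 // ltW.
have powM k : (2 * k <= (kA + kB).+1)%N -> (n ^ k)%:R <= delta * m%:R.
  move=> hk; rewrite -(@ler_pXn2r _ 2) ?nnegrE ?ler0n //; apply: le_trans mbig.
  by rewrite -natrX ler_nat -expnM mulnC leq_pexp2l.
(* The lower bracket [sn] bounds the power of [8 / eps ^+ 2] by [n]; the upper bracket [ns] makes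
   [(2 * c ^+ 2) ^+ (2 ^ s)] at most [n ^- t], like the bias. With the [n ^ (t - 2)] vertices this
   leaves a multiple of [1 / n]. *)
have tail T : T != [set: 'I_t] ->
    Ex D (fun y => ((3 * (eps * m%:R) <= `|monomial_sum T y|)%R)%:R) <= 6 / n%:R.
  move=> TT; apply: le_trans (monomial_tail (s := s) TT mR0 eps0 delta0 c0 c1 gamma0 bD d1 d2 JM n0 _ _ _ mbig) _.
  - by have := powM 1%N; rewrite expn1; apply; move: kA0; clear; lia.
  - by apply: powM; move: kAB; clear; lia.
  - by apply: powM; move: kBA; clear; lia.
  have -> : 6 / n%:R = 3 * (n%:R * ((n ^ (kA + kB))%:R * (2 * n%:R ^- t))) :> R.
    rewrite natrX /t !exprS; field.
    by rewrite ?expf_neq0 ?pnatr_eq0 ?(gtn_eqF n0) // lt0n_neq0.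
  apply: ler_wpM2l => //; apply: ler_pM.
  - by rewrite exprn_ge0 // divr_ge0 // sqr_ge0.
  - by rewrite mulr_ge0 // addr_ge0 // exprn_ge0 // mulr_ge0 // sqr_ge0.
  - have -> : 8 / eps ^+ 2 = 2 ^+ (4 * t + 7) :> R.
      have -> : 8 = 2 ^+ 3 :> R by rewrite -natrX.
      rewrite /eps exprVn invrK -exprM -exprD; congr (_ ^+ _).
      by clear; move: t; lia.
    rewrite -!natrX ler_nat -expnM (_ : _ * _ = (8 * t + 14) * 2 ^ s)%N ?expnM //.
    by move: (2 ^ s)%N; clear; move: t; nia.
  apply: ler_wpM2l => //; rewrite [leRHS]mulr_natl mulr2n; apply: lerD => //.
  have c2 : 2 * c ^+ 2 <= 2 ^- ((8 * t + 14) * (2 * t)) :> R.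
    rewrite /c exprVn -exprM ler_pdivrMr ?exprn_gt0 // mulrC ler_pdivlMr ?exprn_gt0 //.
    rewrite -exprS ler_eXn2l ?ltr1n //.
    by rewrite mulnCA [(_ * t)%N]mulnC; move: (t * _)%N; clear; lia.
  apply: le_trans (_ : (2 ^- ((8 * t + 14) * (2 * t))) ^+ (2 ^ s) <= _).
    by apply: lerXn2r c2; rewrite nnegrE ?invr_ge0 ?exprn_ge0 // mulr_ge0 ?sqr_ge0.
  rewrite exprVn lef_pV2 ?posrE ?exprn_gt0 ?ltr0n // -!natrX ler_nat.
  have -> : ((2 ^ ((8 * t + 14) * (2 * t))) ^ 2 ^ s = ((2 ^ (8 * t + 14)) ^ (2 ^ s * 2)) ^ t)%N.
    have tk k : (2 * (t * k) = k * (2 * t))%N by rewrite [RHS]mulnCA [(t * k)%N]mulnC.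
    by rewrite -!expnM -!mulnA tk.
  by rewrite leq_exp2r // ltnW.
have t2 : 0 < 2 ^+ t :> R by rewrite exprn_gt0.
have nR0 : 0 < n%:R :> R by rewrite ltr0n.
(* If every monomial sum were small at a point of the support, their total would fall below
   [m / 2 ^+ t], against [sum_monomial_sum_ge]. So some type is always large, and a union bound over
   at most [2 ^ t] types contradicts [tn]. *)
have : 1 <= 2 ^+ t * (6 / n%:R) :> R.
  apply: le_trans (_ : Ex D (fun y => \sum_(T | T != [set: 'I_t])
      ((3 * (eps * m%:R) <= `|monomial_sum T y|)%R)%:R) <= _).
    rewrite -[leLHS](Ex_cst D); apply: ler_Ex => y Dy.
    have [/existsP[T /andP[TT hT]]|] := boolP [exists (T | T != [set: 'I_t]),
        3 * (eps * m%:R) <= `|monomial_sum T y|].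
      by rewrite (bigD1 T) //= hT lerDl sumr_ge0.
    rewrite negb_exists => /forallP small.
    have := sum_monomial_sum_ge Dy; rewrite leNgt => /negP[].
    apply: le_lt_trans (_ : 2 ^+ t * (3 * (eps * m%:R)) < _).
      have <- : #|{set 'I_t}|%:R = 2 ^+ t :> R by rewrite -cardsT -powersetT card_powerset cardsT card_ord natrX.
      rewrite mulr_natl -sumr_const big_mkcond /=; apply: ler_sum => T _.
      have e0 : 0 <= 3 * (eps * m%:R) by rewrite !mulr_ge0 // ltW.
      case: ifP => // TT; apply: le_trans (ler_norm _) _.
      by have := small T; rewrite TT /= -ltNge => /ltW.
    apply: lt_le_trans (_ : m%:R / 2 ^+ t <= _).
      rewrite ltr_pdivlMr // /eps exprD mulnC exprM.
      have -> : 2 ^+ t * (3 * (((2 ^+ t) ^+ 2 * 2 ^+ 2)^-1 * m%:R)) * 2 ^+ t = 3 / 4 * m%:R :> R.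
        by field; rewrite gt_eqF.
      by lra.
    rewrite mulrA ler_pM2r ?invr_gt0 // -natrM ler_nat mulnC //.
  rewrite Ex_sum.
  have <- : #|{set 'I_t}|%:R = 2 ^+ t :> R by rewrite -cardsT -powersetT card_powerset cardsT card_ord natrX.
  rewrite [leRHS]mulr_natl -sumr_const big_mkcond /=; apply: ler_sum => T _.
  by case: ifP => [/tail //|_]; rewrite divr_ge0.
rewrite mulrA ler_pdivlMr // mul1r -natrX -natrM ler_nat mulnC.
by rewrite leqNgt tn.
Qed.
End LowDegree.

(** * From the data structure to the space bound *)

(** List the probed cells and fill the list up with cell 0 to [t.+1] positions; decoding finds each
    probed cell at its index in the list. *)
Lemma probes_tuple (N m S t : nat) (f : problem N m) (ds : nonadaptive_ds f S t.+1) :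
  (0 < S)%N ->
  exists (q : 'I_m -> 'I_t.+1 -> 'I_S) (G : 'I_m -> bits t.+1 -> bool),
    forall i j, f i j = G j [ffun k => encode ds i (q j k)].
Proof.
move=> S0; pose s j := enum (probes ds j).
exists (fun j k => nth (Ordinal S0) (s j) k).
exists (fun j (x : bits t.+1) =>
  decode (read (probes ds j) [ffun k => x (inord (index k (s j)) : 'I_t.+1)])).
move=> i j; rewrite -(decodeP ds); congr decode; apply/ffunP => k; rewrite !ffunE.
have ks : val k \in s j by rewrite mem_enum (valP k).
rewrite inordK ?nth_index //; apply: leq_trans (probes_le ds j).
by rewrite cardE index_mem.
Qed.

(** Repeated squaring needs a walk length that is a power of two, and the tail bound needs one of
    order log [n]: round the base-[b] logarithm down to a power of two. *)
Lemma power_of_two_bracket (b n : nat) : (1 < b)%N -> (b <= n)%N ->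
  exists s, (b ^ 2 ^ s <= n < b ^ (2 ^ s * 2))%N.
Proof.
move=> b1 bn; pose L := trunc_log b n.
have n0 : (0 < n)%N by apply: leq_trans bn; apply: ltnW.
have L0 : (0 < L)%N by rewrite trunc_log_gt0 b1 /=; move: b1 bn; clear; lia.
exists (trunc_log 2 L); apply/andP; split.
  by apply: leq_trans (trunc_logP b1 n0); rewrite leq_exp2l // trunc_logP.
apply: leq_trans (trunc_log_ltn n b1) _; rewrite leq_exp2l // -expnSr.
exact: trunc_log_ltn.
Qed.

(** For [m <= 2 * S] the exponent being at most 1 suffices; for [S <= n0] the number of queries is
    bounded and the constant absorbs it. Otherwise at least half of the answers are not full
    parities, and [queries_lt] loses only a factor [Y] of order [2 ^ s], which is at most of order
    [ln m]. *)
Lemma space_lower_bound (R : realType) (C : R) (kA kB : nat) (t := (kA + kB).+2) :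
  0 < C -> (0 < kA)%N -> (kB <= kA <= kB.+1)%N ->
  exists c : R, 0 < c /\
    forall (N m S : nat) (f : problem N m), (1 < m)%N -> (0 < S)%N ->
      (exists D : distr R m,
         supported_on_rows D f /\
         biased (2 `^ (- (C * t%:R)) * S%:R ^- t) D) ->
      forall ds : nonadaptive_ds f S t,
        c * m%:R `^ (2 / (t%:R - 1)) / ln m%:R ^+ 1 <= S%:R.
Proof.
move=> C0 kA0 /andP[kBA kAB].
(* Above [n0] the walk length can be bracketed and the union bound over types succeeds. *)
pose b := (2 ^ (8 * t + 14))%N; pose n0 := (b + 6 * 2 ^ t)%N.
pose c : R := 2 ^- (t * (8 * t + 14)).+1.
have c0 : 0 < c by rewrite invr_gt0 exprn_gt0.
have c1 : c <= 1 by rewrite invf_le1 ?exprn_gt0 // exprn_ege1 // ler1n.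
have c40 : 0 < c ^+ 4 by rewrite exprn_gt0.
have c41 : c ^+ 4 <= 1 by rewrite exprn_ile1 // ltW.
have l20 : 0 < ln 2 :> R by rewrite ln_gt0 // ltr1n.
(* [2 ^- n0] serves the range [S <= n0]; [c ^+ 4 / 4] cancels the constant in [Y] above it. *)
pose K : R := 2 ^- n0 * (c ^+ 4 / 4).
have p0 : 0 < 2 ^- n0 :> R by rewrite invr_gt0 exprn_gt0.
have p1 : 2 ^- n0 <= 1 :> R by rewrite invf_le1 ?exprn_gt0 // exprn_ege1 // ler1n.
have K0 : 0 < K by rewrite mulr_gt0 // divr_gt0.
have K1 : K <= 2 ^- n0 / 4 by rewrite /K mulrA ler_pM2r ?invr_gt0 // ler_piMr // ltW.
have K2 : K <= c ^+ 4 / 4 by rewrite /K ler_piMl // ltW // divr_gt0.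
exists (ln 2 * K); split; first exact: mulr_gt0.
move=> N m S f m1 S0 [D [suppD bD]] ds.
have m0 : (0 < m)%N by apply: ltnW.
have mR : 1 <= m%:R :> R by rewrite ler1n.
have SR : 1 <= S%:R :> R by rewrite ler1n.
have lm : ln 2 <= ln m%:R :> R by rewrite ler_ln ?posrE ?ltr0n // ler_nat.
have lm0 : 0 < ln m%:R :> R by apply: lt_le_trans lm.
have tE : t%:R - 1 = (kA + kB).+1%:R :> R by rewrite /t -natr1 addrK.
rewrite tE expr1 ler_pdivrMr //; set d := (kA + kB).+1; set r : R := 2 / d%:R.
have dR : 0 < d%:R :> R by rewrite ltr0n.
have r1 : r <= 1 by rewrite /r ler_pdivrMr // mul1r ler_nat /d; move: kA0; clear; lia.
have mrm : m%:R `^ r <= m%:R by apply: ler1_powR.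
have mr0 : 0 <= m%:R `^ r by apply: powR_ge0.
have [q [G fG]] := probes_tuple ds S0.
set g := 2 `^ _ in bD.
have g0 : 0 <= g by apply: powR_ge0.
have g1 : g < 1.
  by rewrite /g /powR pnatr_eq0 /= expR_lt1 mulNr oppr_lt0 !mulr_gt0 // ltr0n.
have St0 : 0 < S%:R ^- t :> R by rewrite invr_gt0 exprn_gt0 // ltr0n.
have St1 : S%:R ^- t <= 1 :> R by rewrite invf_le1 ?exprn_gt0 ?ltr0n // exprn_ege1.
set gamma := g * _ in bD.
have gamma0 : 0 <= gamma by rewrite mulr_ge0 // ltW.
have gammaS : gamma <= S%:R ^- t by rewrite /gamma ler_piMl // ltW.
have gamma1 : gamma < 1 by apply: le_lt_trans g1; rewrite /gamma ler_piMr.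
have rep y : D y != 0 -> exists E : bits S, forall j, y j = G j [ffun k => E (q j k)].
  by move=> /suppD[i ->]; exists (encode ds i) => j; rewrite ffunE fG.
have weak : K * m%:R `^ r <= S%:R -> ln 2 * K * m%:R `^ r <= S%:R * ln m%:R.
  move=> h; rewrite -mulrA mulrC; apply: ler_pM => //; last exact: ltW.
  by rewrite mulr_ge0 // ltW.
have weak2 : m%:R <= 2 * S%:R :> R -> ln 2 * K * m%:R `^ r <= S%:R * ln m%:R.
  by move=> h; apply: weak; have := le_trans mrm h; nra.
have [Sm|mS] := leqP m (2 * S)%N; first by apply: weak2; rewrite -natrM ler_nat.
have [Sn0|n0S] := leqP S n0.
  apply: weak; have := queries_le_exp gamma1 bD rep.
  have : (2 ^ S <= 2 ^ n0)%N by rewrite leq_exp2l.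
  move=> h /leq_trans/(_ h); rewrite -(ler_nat R) natrX => mn0.
  apply: le_trans SR; apply: le_trans (_ : 2 ^- n0 * 2 ^+ n0 <= _); last first.
    by rewrite mulVf // gt_eqF // exprn_gt0.
  apply: ler_pM => //; first exact: ltW; last exact: le_trans mrm mn0.
  by move: K1 p0; lra.
have b1 : (1 < b)%N by rewrite /b -{1}(expn0 2) ltn_exp2l // addnS.
have bS : (b <= S)%N by apply: leq_trans (ltnW n0S); rewrite /n0 leq_addr.
have tS : (6 * 2 ^ t < S)%N by apply: leq_ltn_trans n0S; rewrite /n0 leq_addl.
have [s /andP[sS Ss]] := power_of_two_bracket b1 bS.
have mJ : (m <= 2 * #|[set j | ~~ is_full_parity (G j)]|)%N.
  have := card_full_parity_le gamma1 bD rep.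
  set P := [set j | is_full_parity (G j)] => PS.
  have -> : [set j | ~~ is_full_parity (G j)] = ~: P by apply/setP => j; rewrite !inE.
  have := cardsC P; rewrite card_ord; move: PS mS; clear; lia.
have := queries_lt rep kAB kBA kA0 S0 gamma0 gammaS bD sS Ss tS m0 mJ.
cbv zeta; rewrite -/t -/c -/d => lt.
pose Y : R := (2 ^ s * 4)%:R / c ^+ 4.
have k0 : 0 < (2 ^ s * 4)%:R :> R by rewrite ltr0n muln_gt0 expn_gt0.
have Y1 : 1 <= Y.
  rewrite ler_pdivlMr // mul1r (le_trans c41) // ler1n muln_gt0 expn_gt0.
  by [].
(* Since [Y >= 1] and [d >= 2], [Y ^+ 2 * S ^+ d] is at most [(Y * S) ^+ d], whose [d]-th root can
   be taken. *)
have mY : m%:R `^ r <= Y * S%:R.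
  rewrite leNgt; apply/negP => h; move: lt; apply/negP; rewrite -leNgt.
  have -> : c ^+ 4 / (2 ^ s * 4)%:R = Y^-1 by rewrite /Y invf_div.
  rewrite exprMn exprVn natrX mulrC ler_pdivlMr ?exprn_gt0 ?(lt_le_trans ltr01) //.
  apply: le_trans (_ : (Y * S%:R) ^+ d <= _).
    rewrite [(Y * _) ^+ d]exprMn [leLHS]mulrC; apply: ler_wpM2r; first by rewrite exprn_ge0.
    by rewrite ler_weXn2l // /d; move: kA0; clear; lia.
  apply: le_trans (_ : (m%:R `^ r) ^+ d <= _).
    have Y0 : 0 <= Y := le_trans ler01 Y1.
    by apply: lerXn2r; rewrite ?nnegrE; [exact: mulr_ge0 | exact: mr0 | exact: ltW].
  by rewrite -powR_mulrn // -powRrM /r mulfVK ?gt_eqF // powR_mulrn.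
(* The logarithm in the bound pays for the walk length: [2 ^ (2 ^ s) <= b ^ (2 ^ s) <= S <= m]. *)
have ls : ln 2 * (2 ^ s)%:R <= ln m%:R :> R.
  rewrite mulr_natr -lnXn ?ltr0n // ler_ln ?posrE ?exprn_gt0 ?ltr0n //.
  rewrite -natrX ler_nat; apply: leq_trans (_ : b ^ 2 ^ s <= _)%N.
    by rewrite leq_exp2r ?expn_gt0.
  by apply: leq_trans sS _; move: mS; clear; lia.
apply: le_trans (_ : ln 2 * (c ^+ 4 / 4) * (Y * S%:R) <= _).
  apply: ler_pM => //; first by rewrite mulr_ge0 // ltW.
  by rewrite ler_pM2l.
have -> : ln 2 * (c ^+ 4 / 4) * (Y * S%:R) = S%:R * (ln 2 * (2 ^ s)%:R).
  by rewrite /Y natrM; field; rewrite gt_eqF.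
by rewrite ler_wpM2l.
Qed.

Theorem theorem1p4 (R : realType) :
  exists k : nat, forall (C : R) (t : nat), 0 < C -> (3 <= t)%N ->
  exists c : R, 0 < c /\
    forall (N m S : nat) (f : problem N m), (1 < m)%N -> (0 < S)%N ->
      (exists D : distr R m,
         supported_on_rows D f /\
         biased (2 `^ (- (C * t%:R)) * S%:R ^- t) D) ->
      forall ds : nonadaptive_ds f S t,
        c * m%:R `^ (2 / (t%:R - 1)) / ln m%:R ^+ k <= S%:R.
Proof.
exists 1%N => C t C0 t3.
have [kA [kB [-> kA0 kAB]]] : exists kA kB : nat,
    [/\ t = (kA + kB).+2, (0 < kA)%N & (kB <= kA <= kB.+1)%N].
  (* The larger half goes to [kA], which keeps it positive when [t = 3]. *)
  by exists (uphalf (t - 2)), (t - 2)./2; split; lia.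
exact: space_lower_bound.
Qed.
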